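(* Let $T\ge2$, let $h,k$ be natural numbers, and let $\alpha\in\mathbb C$ with $\alpha\ne0$ and $|\alpha|\le\frac1{15\log T}$. Then $$\overline{\frac d{d\gamma}\frac1{2\pi}\int_0^T\left(Z_{\overline\alpha,\gamma,h,k}+\Big(\frac t{2\pi}\Big)^{-\overline\alpha-\gamma}Z_{-\gamma,-\overline\alpha,h,k}\right)dt\,\Bigg|_{\gamma=0}}=\mathcal F_{\alpha,h,k}(T),$$ where $$\mathcal F_{\alpha,h,k}(T)=\frac T{2\pi}\left(\frac{\mathbb 1_{k=1}}{h^\alpha}\frac{\zeta'}{\zeta}(1+\alpha)-\frac{\Lambda(k)}{h^\alpha\Phi(1+\alpha,k)}-\frac k{\varphi(k)}\Phi(\alpha,k)\zeta(1-\alpha)\frac{\left(\frac T{2\pi k}\right)^{-\alpha}}{1-\alpha}\right).$$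
   Context: $$Z_{\alpha,\gamma,h,k}=\frac1{h^\alpha k^\gamma}\frac{\zeta(1+\alpha+\gamma)}{\zeta(1+\alpha)}\prod_{p\mid k}\frac{1-p^\gamma}{1-p^{-1-\alpha}},$$ with $1/\zeta(1-\gamma)$ extended analytically by $0$ at $\gamma=0$ in $Z_{-\gamma,-\overline\alpha,h,k}$. $\Phi(s,k)=\prod_{p\mid k}(1-p^{-s})$ (empty product $=1$); $\Lambda$ is the von Mangoldt function, $\varphi$ Euler's totient; $\mathbb 1_{k=1}$ equals $1$ if $k=1$ and $0$ otherwise; the bar is complex conjugation. *)

(* Defs.v *)
From mathcomp Require Export ssreflect ssrfun ssrbool eqtype ssrnat seq bigop prime.
From Stdlib Require Export Reals.
From Stdlib Require Import Lra.
From Coquelicot Require Export Coquelicot.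

Set Implicit Arguments.
Unset Strict Implicit.
Unset Printing Implicit Defensive.

Local Open Scope R_scope.

Definition Cexp (z : C) : C := (exp (Re z) * cos (Im z), exp (Re z) * sin (Im z)).

(* [cpow x s] is x^s for real x > 0, with the real logarithm of x. *)
Definition cpow (x : R) (s : C) : C := Cexp (s * RtoC (ln x))%C.

(* sum_(1 <= n <= N+1) n^(-s) - (N+1)^(1-s) / (1-s) *)
Definition zeta_seq (s : C) (N : nat) : C :=
  (sum_n (fun n => cpow (INR n.+1) (- s)) N - cpow (INR N.+1) (1 - s) / (1 - s))%C.

(* The Riemann zeta function on the half-plane Re s > 0, s <> 1.  For Re s > 1
   the subtracted term tends to 0, which leaves the Dirichlet series
   (see [zeta_dirichlet]).  The limit exists and is holomorphic for Re s > 0,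
   s <> 1, because the increments are O(|s| n^(-1-Re s)); hence on the rest of
   this domain it is the analytic continuation.  Nothing is claimed at s = 1 or
   for Re s <= 0. *)
Definition zeta (s : C) : C :=
  (real (Lim_seq (fun N => Re (zeta_seq s N))),
   real (Lim_seq (fun N => Im (zeta_seq s N)))).

Lemma Cmod_Cexp (z : C) : Cmod (Cexp z) = exp (Re z).
Proof.
rewrite /Cexp; move: (Re z) (Im z) => u v.
rewrite /Cmod /fst /snd.
replace (_ + _)%R with (exp u ^ 2)%R; last first.
  by have := sin2_cos2 v; rewrite /Rsqr => h; rewrite -[LHS]Rmult_1_r -h; ring.
by rewrite sqrt_pow2 //; exact/Rlt_le/exp_pos.
Qed.

Lemma Cmod_cpow (x : R) (s : C) : Cmod (cpow x s) = exp (Re s * ln x).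
Proof. by rewrite /cpow Cmod_Cexp; congr exp; rewrite /Re /=; ring. Qed.

Lemma filterlim_Cmod0 (u : nat -> C) :
  is_lim_seq (fun n => Cmod (u n)) 0 ->
  filterlim u eventually (locally (T := C_UniformSpace) (RtoC 0)).
Proof.
move=> H P [eps He].
have [N HN] := H _ (locally_ball (0 : R) eps).
exists N => n hn; apply: He; apply: C_NormedModule_mixin_compat1.
have := HN n hn; rewrite /ball /= /AbsRing_ball /abs /minus /plus /opp /=.
rewrite Ropp_0 Rplus_0_r Rabs_pos_eq; last exact: Cmod_ge_0.
by rewrite Copp_0 Cplus_0_r.
Qed.

Lemma is_lim_Rpow_neg (a : R) : 0 < a ->
  is_lim_seq (fun n => exp (- a * ln (INR n.+1))) 0.
Proof.
move=> ha.
apply: (is_lim_comp_seq exp _ m_infty).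
- exact: is_lim_exp_m.
- by exists 0%nat.
have := is_lim_seq_scal_l (fun n => ln (INR n.+1)) (- a) p_infty.
have -> : Rbar_mult (- a) p_infty = m_infty.
  rewrite /Rbar_mult /=; case: Rle_dec => h; last by [].
  by exfalso; lra.
apply; apply: (is_lim_comp_seq ln _ p_infty).
- exact: is_lim_ln_p.
- by exists 0%nat.
exact/(is_lim_seq_incr_1 INR)/is_lim_seq_INR.
Qed.

Lemma cpow_real_step (a x : R) : 0 < a -> 1 <= x ->
  a * exp (- (1 + a) * ln (x + 1)) <= exp (- a * ln x) - exp (- a * ln (x + 1)).
Proof.
move=> ha hx.
have h1 : / (x + 1) <= ln (x + 1) - ln x.
  have -> : ln (x + 1) - ln x = - ln (x / (x + 1)) by rewrite ln_div; lra.
  have := exp_ineq1_le (ln (x / (x + 1))).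
  rewrite exp_ln; last by apply: Rdiv_lt_0_compat; lra.
  have -> : x / (x + 1) = 1 - / (x + 1) by field; lra.
  lra.
have h2 : 1 + a * / (x + 1) <= exp (a * (ln (x + 1) - ln x)).
  apply: Rle_trans (exp_ineq1_le _).
  by apply: Rplus_le_compat_l; apply: Rmult_le_compat_l; lra.
have e1 : exp (- a * ln x)
    = exp (- a * ln (x + 1)) * exp (a * (ln (x + 1) - ln x)).
  by rewrite -exp_plus; congr exp; ring.
have e2 : exp (- (1 + a) * ln (x + 1)) = exp (- a * ln (x + 1)) * / (x + 1).
  have -> : - (1 + a) * ln (x + 1) = - a * ln (x + 1) + - ln (x + 1) by ring.
  by rewrite exp_plus exp_Ropp exp_ln //; lra.
rewrite e1 e2.
have := exp_pos (- a * ln (x + 1)); nra.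
Qed.

Lemma ex_series_Rpow (a : R) : 0 < a ->
  ex_series (fun n => exp (- (1 + a) * ln (INR n.+1))).
Proof.
move=> ha; apply/ex_series_incr_1.
pose b n := exp (- a * ln (INR n.+1)).
apply: (ex_series_le _ (fun n => / a * (b n - b n.+1))) => [n|].
  rewrite /norm /= /abs /= Rabs_pos_eq; last exact/Rlt_le/exp_pos.
  have h1 : 1 <= INR n.+1 by rewrite S_INR; have := pos_INR n; lra.
  have := cpow_real_step ha h1; rewrite -S_INR => H.
  apply: (Rmult_le_reg_l a) => //.
  rewrite -Rmult_assoc Rinv_r ?Rmult_1_l; last lra.
  exact: H.
apply: ex_series_scal_l.
exists (1 : R).
have E n : sum_n (fun k => b k - b k.+1) n = 1 - b n.+1.
  elim: n => [|n IH]; last by rewrite sum_Sn IH /plus /=; ring.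
  by rewrite sum_O /b /= ln_1 Rmult_0_r exp_0.
suff H : is_lim_seq (fun n => 1 - b n.+1) 1 by apply: is_lim_seq_ext H.
replace (Finite 1) with (Finite (1 - 0)) by (congr Finite; ring).
apply: is_lim_seq_minus'; first exact: is_lim_seq_const.
exact/(is_lim_seq_incr_1 b)/is_lim_Rpow_neg.
Qed.

Lemma zeta_dirichlet (s : C) : 1 < Re s ->
  is_series (fun n => cpow (INR n.+1) (- s)) (zeta s).
Proof.
move=> hs.
have [l hl] : ex_series (fun n => cpow (INR n.+1) (- s)).
  apply: (ex_series_le (V := C_CompleteNormedModule) _
           (fun n => exp (- (1 + (Re s - 1)) * ln (INR n.+1)))) => [n|].
    apply: Req_le; rewrite [LHS]Cmod_cpow; congr exp.
    by rewrite /Re /=; ring.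
  by apply: ex_series_Rpow; lra.
suff <- : l = zeta s by [].
have h0 : filterlim (zeta_seq s) eventually (locally (T := C_UniformSpace) l).
  have -> : l = (l + - RtoC 0)%C by rewrite Copp_0 Cplus_0_r.
  pose u n := (cpow (INR n.+1) (1 - s) / (1 - s))%C.
  suff hu : filterlim u eventually (locally (T := C_UniformSpace) (RtoC 0)).
    have hv := filterlim_comp _ _ _ _ _ _ _ _ hu (filterlim_opp (V := C_NormedModule) (RtoC 0)).
    have H := (filterlim_comp_2 _ _ _ hl hv
              (filterlim_plus (V := C_NormedModule) l (Copp (RtoC 0)))).
    exact: H.
  apply: filterlim_Cmod0.
  have hne : (1 - s)%C <> RtoC 0.
    by move=> /(f_equal fst); move: hs; rewrite /Re /=; lra.
  apply: (is_lim_seq_ext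
    (fun n => / Cmod (1 - s) * exp (- (Re s - 1) * ln (INR n.+1)))) => [n|].
    rewrite Cmod_div // Cmod_cpow /Rdiv Rmult_comm; congr (exp _ * _).
    by rewrite /Re /=; ring.
  have -> : Finite 0 = Rbar_mult (/ Cmod (1 - s)) 0 by rewrite /= Rmult_0_r.
  by apply: is_lim_seq_scal_l; apply: is_lim_Rpow_neg; lra.
rewrite /zeta.
rewrite (is_lim_seq_unique _ (Re l)) ?(is_lim_seq_unique _ (Im l)) /=.
- by case: (l).
- move=> P [eps He]; have [N HN] := h0 _ (locally_ball _ eps).
  by exists N => n /HN [_ h]; apply: He.
- move=> P [eps He]; have [N HN] := h0 _ (locally_ball _ eps).
  by exists N => n /HN [h _]; apply: He.
Qed.

(* 1/zeta, with the pole of zeta at 1 giving the analytic value 0. *)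
Definition inv_zeta (s : C) : C := if Ceq_dec s 1 then RtoC 0 else (/ zeta s)%C.

Definition Phi (s : C) (k : nat) : C :=
  \big[Cmult/RtoC 1]_(p <- primes k) (1 - cpow (INR p) (- s))%C.

(* Von Mangoldt: ln p when k = p^e is the prime factorization of k, e >= 1. *)
Definition vonMangoldt (k : nat) : R :=
  if prime_decomp k is [:: (p, _)] then ln (INR p) else 0.

Definition Zterm (a g : C) (h k : nat) : C :=
  (1 / (cpow (INR h) a * cpow (INR k) g)
   * (zeta (1 + a + g) * inv_zeta (1 + a))
   * \big[Cmult/RtoC 1]_(p <- primes k)
       ((1 - cpow (INR p) g) / (1 - cpow (INR p) (- (1) - a))))%C.

Definition integrand (alpha : C) (h k : nat) (gamma : C) (t : R) : C :=
  (Zterm (Cconj alpha) gamma h k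
   + cpow (t / (2 * PI)) (- Cconj alpha - gamma)
     * Zterm (- gamma) (- Cconj alpha) h k)%C.

(* The integrand may be unbounded at t = 0, so the integral over (0, T] is
   improper at 0. *)
Definition mean_integral (alpha : C) (h k : nat) (T : R) (gamma : C) : C :=
  (RtoC (/ (2 * PI))
   * RInt_gen (V := C_R_CompleteNormedModule)
       (integrand alpha h k gamma) (at_right 0) (at_point T))%C.

Definition Fmain (alpha : C) (h k : nat) (T : R) : C :=
  (RtoC (T / (2 * PI))
   * (RtoC (if k == 1%nat then 1 else 0) / cpow (INR h) alpha
        * (C_derive zeta (1 + alpha) / zeta (1 + alpha))
      - RtoC (vonMangoldt k) / (cpow (INR h) alpha * Phi (1 + alpha) k)
      - RtoC (INR k / INR (totient k)) * Phi alpha k * zeta (1 - alpha)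
        * (cpow (T / (2 * PI * INR k)) (- alpha) / (1 - alpha))))%C.

(* Main.v *)
From Stdlib Require Import Lra.
Require Import Defs.

(** Write [a] for the conjugate of [alpha]. The integrand is a constant in [t]
    plus a power [t^(-a-gamma)] times a constant, so near [gamma = 0] its integral
    is elementary ([is_RInt_gen_integrand]) and the statement becomes the
    computation of one complex derivative at 0.

    In the first constant, [Zterm a gamma h k], the product over the primes
    dividing [k] has a zero at [gamma = 0] whose order is the number of those
    primes. Hence its derivative sees [zeta'/zeta (1 + a)] when [k = 1], the
    single logarithm of a von Mangoldt term when [k] is a prime power, and
    nothing otherwise ([is_Cderive_Zterm_first]). The second constant contains
    [1 / zeta (1 - gamma)], which vanishes at 0 with derivative -1; so its
    derivative is minus the value of everything that multiplies this factor
    ([is_Cderive_Zterm_second]), and Euler's product for the totient puts that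
    value in the stated form. Everything commutes with complex conjugation,
    which finally turns [a] into [alpha].

    The analytic facts needed are that [zeta] is complex differentiable at
    [1 + a] and [1 - a], that [zeta (1 + a)] is not 0, and that [inv_zeta] has
    derivative 1 at 1. They all come from the increments of [zeta_seq]: each is
    the error of the right endpoint rule for the integral of [x^(-s)] over a unit
    interval. Bounding these errors shows that
    [zeta s - 1 / (s - 1)] is given by an absolutely convergent series and is
    bounded by an explicit constant near 1, smaller than [1 / |a|] since
    [|a| <= 1 / (15 ln 2) < 1/7] ([zeta_near_pole]). Bounding the second-order
    Taylor remainders of the same errors in [s] by a summable sequence
    ([zeta_incr_taylor]) allows differentiation term by term
    ([ex_Cderive_zeta]). The Taylor remainders are estimated by mean value
    inequalities for complex functions of a real variable, so no contour
    integral enters. *)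

Set Implicit Arguments.
Unset Strict Implicit.
Unset Printing Implicit Defensive.

Local Open Scope R_scope.

(** * Complex exponentials and powers *)

Lemma Cext (z w : C) : Re z = Re w -> Im z = Im w -> z = w.
Proof. by case: z w => [a b] [c d] /= -> ->. Qed.

Lemma Cexp_plus (z w : C) : Cexp (z + w) = (Cexp z * Cexp w)%C.
Proof.
by apply: Cext; rewrite /Re /Im /= exp_plus ?cos_plus ?sin_plus /Re /Im; ring.
Qed.

Lemma Cexp_0 : Cexp 0 = 1.
Proof. by rewrite /Cexp /= exp_0 cos_0 sin_0 Rmult_1_r Rmult_0_r. Qed.

Lemma Cexp_neq0 (z : C) : Cexp z <> 0.
Proof.
move=> h; have := Cmod_Cexp z; rewrite h Cmod_0.
by have := exp_pos (Re z); lra.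
Qed.

Lemma Cexp_conj (z : C) : Cconj (Cexp z) = Cexp (Cconj z).
Proof. by rewrite /Cexp /Cconj /= cos_neg sin_neg Ropp_mult_distr_r. Qed.

Lemma cpow_plus (x : R) (s t : C) : cpow x (s + t) = (cpow x s * cpow x t)%C.
Proof. by rewrite /cpow -Cexp_plus; congr Cexp; ring. Qed.

Lemma cpow_0 (x : R) : cpow x 0 = 1.
Proof. by rewrite /cpow Cmult_0_l Cexp_0. Qed.

Lemma cpow_neq0 (x : R) (s : C) : cpow x s <> 0.
Proof. exact: Cexp_neq0. Qed.

Lemma cpow_opp (x : R) (s : C) : cpow x (- s) = (/ cpow x s)%C.
Proof.
have h := @cpow_neq0 x s.
have e : (cpow x (- s) * cpow x s)%C = 1.
  by rewrite -cpow_plus Cplus_comm Cplus_opp_r cpow_0.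
by rewrite -[LHS]Cmult_1_r -(Cinv_r _ h) Cmult_assoc e Cmult_1_l.
Qed.

Lemma cpow_1 (x : R) : 0 < x -> cpow x 1 = RtoC x.
Proof.
move=> hx; rewrite /cpow Cmult_1_l.
by rewrite /Cexp /= exp_ln // cos_0 sin_0 Rmult_1_r Rmult_0_r.
Qed.

Lemma cpow_base1 (s : C) : cpow 1 s = 1.
Proof. by rewrite /cpow ln_1 Cmult_0_r Cexp_0. Qed.

Lemma cpow_mult (x y : R) (s : C) : 0 < x -> 0 < y ->
  cpow (x * y) s = (cpow x s * cpow y s)%C.
Proof.
by move=> hx hy; rewrite /cpow ln_mult // RtoC_plus Cmult_plus_distr_l Cexp_plus.
Qed.

Lemma cpow_conj (x : R) (s : C) : Cconj (cpow x s) = cpow x (Cconj s).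
Proof.
by rewrite /cpow Cexp_conj Cmult_conj; congr (Cexp (_ * _)); apply: Cext => //=; ring.
Qed.

(** * Complex-valued functions of a real variable *)

Lemma is_derive_curve (h : R -> C) (t : R) (l : C) :
  is_derive (fun x => Re (h x)) t (Re l) ->
  is_derive (fun x => Im (h x)) t (Im l) ->
  is_derive (V := C_R_NormedModule) h t l.
Proof.
move=> h1 h2.
have k1 := is_derive_scal_l (V := C_R_NormedModule) _ _ _ (1, 0) h1.
have k2 := is_derive_scal_l (V := C_R_NormedModule) _ _ _ (0, 1) h2.
have := is_derive_plus _ _ _ _ _ k1 k2.
have E (z : C) : plus (scal (Re z) ((1, 0) : C_R_NormedModule))
    (scal (Im z) ((0, 1) : C_R_NormedModule)) = z.
  by apply: Cext; rewrite /Re /Im /= /plus /scal /= /mult /=; ring.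
rewrite E; apply: is_derive_ext => x; exact: E.
Qed.

Lemma is_derive_linear (V : NormedModule R_AbsRing)
  (L : C_R_NormedModule -> V) (h : R -> C) (t : R) (l : C) :
  is_linear L -> is_derive (V := C_R_NormedModule) h t l ->
  is_derive (fun x => L (h x)) t (L l).
Proof.
move=> hL hh.
have k := filterdiff_comp' h L t _ _ hh (filterdiff_linear L hL).
apply: filterdiff_ext_lin k _ => y; exact: linear_scal.
Qed.

Lemma is_linear_Cmult (c : C) :
  is_linear (U := C_R_NormedModule) (V := C_R_NormedModule) (Cmult c).
Proof.
split.
- by move=> x y; rewrite /plus /=; exact: Cmult_plus_distr_l.
- by move=> k [x y]; apply: Cext; rewrite /Re /Im /= /scal /= /mult /=; ring.
exists (Cmod c + 1); split; first by have := Cmod_ge_0 c; lra.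
move=> x; have E (z : C_R_NormedModule) : norm z = Cmod z.
  rewrite /norm /= /prod_norm /norm /= /abs /Cmod /=; congr sqrt.
  by have := Rsqr_abs z.1; have := Rsqr_abs z.2; rewrite /Rsqr; lra.
by rewrite !E Cmod_mult; have := Cmod_ge_0 x; nra.
Qed.

Lemma is_linear_Re : is_linear (U := C_R_NormedModule) (V := R_NormedModule) Re.
Proof. exact: is_linear_fst. Qed.

Lemma is_linear_Im : is_linear (U := C_R_NormedModule) (V := R_NormedModule) Im.
Proof. exact: is_linear_snd. Qed.

Lemma is_derive_Cmult_const (c : C) (h : R -> C) (t : R) (l : C) :
  is_derive (V := C_R_NormedModule) h t l ->
  is_derive (V := C_R_NormedModule) (fun x => c * h x)%C t (c * l)%C.
Proof. exact: (is_derive_linear (V := C_R_NormedModule) (is_linear_Cmult c)). Qed.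

Lemma is_derive_RtoC (f : R -> R) (t l : R) :
  is_derive f t l -> is_derive (V := C_R_NormedModule) (fun x => RtoC (f x)) t (RtoC l).
Proof.
by move=> hf; apply: is_derive_curve => //; exact: is_derive_const.
Qed.

(** Rotating the increment onto the positive real axis reduces the bound to the
    mean value theorem for one real function. *)
Lemma curve_mean_value (h dh : R -> C) (D x y : R) : x <= y ->
  (forall t, x <= t <= y ->
    is_derive (V := C_R_NormedModule) h t (dh t) /\ Cmod (dh t) <= D) ->
  Cmod (h y - h x) <= D * (y - x).
Proof.
move=> hxy hd; set d := (h y - h x)%C.
have hD : 0 <= D.
  have [_ k] := hd x (conj (Rle_refl _) hxy); have := Cmod_ge_0 (dh x); lra.
have := Cmod_ge_0 d => -[hd0|<-]; last by nra.
have hm : Cmod d <> 0 by lra.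
pose f t := Re (Cconj d * h t).
have hf t : x <= t <= y ->
    is_derive f t (Re (Cconj d * dh t)) /\ Rabs (Re (Cconj d * dh t)) <= Cmod d * D.
  move=> /hd [h1 h2]; split.
    exact: (is_derive_linear is_linear_Re (is_derive_Cmult_const _ h1)).
  apply: Rle_trans (re_le_Cmod _) _; rewrite Cmod_mult Cmod_conj.
  by apply: Rmult_le_compat_l => //; lra.
have E : f y - f x = Cmod d * Cmod d.
  have -> : f y - f x = Re (d * Cconj d) by rewrite /f /d /Re /=; ring.
  by rewrite -Cmod2_conj [Re _]/=; ring.
have [] := MVT_gen f x y (fun t => Re (Cconj d * dh t)).
- rewrite Rmin_left ?Rmax_right // => t ht; apply: proj1 (hf t _); lra.
- rewrite Rmin_left ?Rmax_right // => t ht; apply: derivable_continuous_pt.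
  by exists (Re (Cconj d * dh t)); apply/is_derive_Reals; apply: proj1 (hf t _).
rewrite Rmin_left ?Rmax_right // => c [hc ec].
have [_ kc] := hf c hc; have := Rle_abs (Re (Cconj d * dh c)).
move=> kd; apply: (Rmult_le_reg_l (Cmod d)) => //.
rewrite -E ec -Rmult_assoc; apply: Rmult_le_compat_r; lra.
Qed.

(** * Taylor remainders of the exponential *)

Lemma exp_le (x y : R) : x <= y -> exp x <= exp y.
Proof. by case=> [/exp_increasing|->]; [exact: Rlt_le | exact: Rle_refl]. Qed.

Lemma is_derive_Cexp_line (z : C) (t : R) :
  is_derive (V := C_R_NormedModule) (fun x => Cexp (z * RtoC x)) t
    (z * Cexp (z * RtoC t))%C.
Proof.
case: z => a b; apply: is_derive_curve; rewrite /Cexp /Re /Im /=; auto_derive => //=.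
all: by rewrite /Rminus; ring. Qed.

Lemma Cexp_line_bound (z : C) (t : R) : 0 <= t <= 1 ->
  Cmod (Cexp (z * RtoC t)) <= exp (Cmod z).
Proof.
move=> ht; rewrite Cmod_Cexp; apply: exp_le.
have -> : Re (z * RtoC t) = Re z * t by rewrite /Re /=; ring.
by have := Rle_abs (Re z); have := re_le_Cmod z; have := Cmod_ge_0 z; nra.
Qed.

(** Both remainder bounds are mean value inequalities along the segment from 0
    to [z], on which the modulus of the exponential is at most [exp (Cmod z)];
    the second one integrates the first. *)
Lemma Cexp_sub1_bound (z : C) : Cmod (Cexp z - 1) <= Cmod z * exp (Cmod z).
Proof.
have := @curve_mean_value (fun x => Cexp (z * RtoC x)) (fun x => z * Cexp (z * RtoC x))%C
  (Cmod z * exp (Cmod z)) 0 1 Rle_0_1.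
rewrite Cmult_1_r Cmult_0_r Cexp_0 Rminus_0_r Rmult_1_r; apply=> t ht.
split; first exact: is_derive_Cexp_line.
rewrite Cmod_mult; apply: Rmult_le_compat_l; first exact: Cmod_ge_0.
exact: Cexp_line_bound.
Qed.

Lemma Cexp_sub1_id_bound (z : C) :
  Cmod (Cexp z - 1 - z) <= Cmod z ^ 2 * exp (Cmod z).
Proof.
have := @curve_mean_value (fun x => Cexp (z * RtoC x) - z * RtoC x)%C
  (fun x => z * Cexp (z * RtoC x) - z * 1)%C
  (Cmod z ^ 2 * exp (Cmod z)) 0 1 Rle_0_1.
rewrite !Cmult_1_r !Cmult_0_r Cexp_0 Rminus_0_r Rmult_1_r.
have -> : (Cexp z - z - (1 - 0) = Cexp z - 1 - z)%C by ring.
apply=> t ht; split.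
  apply: (is_derive_minus (V := C_R_NormedModule)); first exact: is_derive_Cexp_line.
  have -> : z = (z * 1)%C by ring.
  rewrite {1}Cmult_1_r.
  by apply: is_derive_Cmult_const; apply: is_derive_RtoC; exact: is_derive_id.
have -> : (z * Cexp (z * t) - z = z * (Cexp (z * t) - 1))%C by ring.
have -> : Cmod z ^ 2 * exp (Cmod z) = Cmod z * (Cmod z * exp (Cmod z)) by ring.
rewrite Cmod_mult; apply: Rmult_le_compat_l; first exact: Cmod_ge_0.
apply: Rle_trans (Cexp_sub1_bound _) _.
have k : Cmod (z * t) <= Cmod z.
  by rewrite Cmod_mult Cmod_R Rabs_pos_eq; [have := Cmod_ge_0 z; nra | lra].
apply: Rmult_le_compat => //; [exact: Cmod_ge_0 | exact/Rlt_le/exp_pos | exact: exp_le].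
Qed.

(** * Complex derivatives *)

Notation is_Cderive := (is_derive (K := C_AbsRing) (V := C_NormedModule)).

(** All the derivatives that do not follow from the algebraic rules (the
    exponential, the inverse, [zeta], [inv_zeta] at its zero) come with a
    second-order Taylor bound, and this lemma turns such a bound into a
    derivative. *)
Lemma is_Cderive_quadratic (f : C -> C) (z l : C) (d M : R) : 0 < d ->
  (forall w, Cmod w < d -> Cmod (f (z + w) - f z - w * l)%C <= M * Cmod w ^ 2) ->
  is_Cderive f z l.
Proof.
move=> hd hf; split; first exact: is_linear_scal_l.
move=> x /is_filter_lim_locally_unique <- eps.
have he := cond_pos eps; have hM := Rabs_pos M.
have hdl : 0 < Rmin d (eps / (Rabs M + 1)).
  by apply: Rmin_pos => //; apply: Rdiv_lt_0_compat; lra.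
exists (mkposreal _ hdl) => y.
rewrite /ball /= /AbsRing_ball /abs /= => hy.
set w := minus y z in hy *.
have h1 := Rlt_le_trans _ _ _ hy (Rmin_l _ _).
have h2 := Rlt_le_trans _ _ _ hy (Rmin_r _ _).
have := hf w h1; have -> : (z + w)%C = y by rewrite /w /minus /plus /opp /=; ring.
have := Cmod_ge_0 w.
change (norm _) with (Cmod (f y - f z - w * l)) at 1.
change (norm w) with (Cmod w).
have h3 : Cmod w * (Rabs M + 1) <= eps.
  apply/Rlt_le/(Rmult_lt_reg_r (/ (Rabs M + 1))); first by apply: Rinv_0_lt_compat; lra.
  by rewrite Rmult_assoc Rinv_r ?Rmult_1_r //; lra.
have := Rle_abs M; nra.
Qed.

(** C carries two uniform structures, the product one and the one of its
    modulus. The product and chain rules hold for the latter; the two notions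
    of derivative agree because they involve only the norm of the codomain,
    which is the same. *)
Lemma is_Cderive_AbsRing (f : C -> C) (z l : C) :
  is_Cderive f z l <-> is_derive (K := C_AbsRing) (V := AbsRing_NormedModule C_AbsRing) f z l.
Proof.
split; move=> [_ h]; split; try exact: is_linear_scal_l; move=> x hx eps; exact: (h x hx eps).
Qed.

Lemma is_Cderive_eq (f : C -> C) (z l l' : C) :
  is_Cderive f z l -> l = l' -> is_Cderive f z l'.
Proof. by move=> h <-. Qed.

Lemma is_Cderive_const (c z : C) : is_Cderive (fun=> c) z (RtoC 0).
Proof. exact: is_derive_const. Qed.

Lemma is_Cderive_id (z : C) : is_Cderive (fun x => x) z (RtoC 1).
Proof. apply/is_Cderive_AbsRing; exact: is_derive_id. Qed.

Lemma is_Cderive_plus (f g : C -> C) (z df dg : C) :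
  is_Cderive f z df -> is_Cderive g z dg ->
  is_Cderive (fun x => f x + g x)%C z (df + dg)%C.
Proof. exact: (is_derive_plus (V := C_NormedModule)). Qed.

Lemma is_Cderive_minus (f g : C -> C) (z df dg : C) :
  is_Cderive f z df -> is_Cderive g z dg ->
  is_Cderive (fun x => f x - g x)%C z (df - dg)%C.
Proof. exact: (is_derive_minus (V := C_NormedModule)). Qed.

Lemma is_Cderive_mult (f g : C -> C) (z df dg : C) :
  is_Cderive f z df -> is_Cderive g z dg ->
  is_Cderive (fun x => f x * g x)%C z (df * g z + f z * dg)%C.
Proof.
move=> /is_Cderive_AbsRing hf /is_Cderive_AbsRing hg; apply/is_Cderive_AbsRing.
exact: (is_derive_mult _ _ _ _ _ hf hg Cmult_comm).
Qed.

Lemma is_Cderive_comp (f g : C -> C) (z df dg : C) :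
  is_Cderive f (g z) df -> is_Cderive g z dg ->
  is_Cderive (fun x => f (g x)) z (df * dg)%C.
Proof.
move=> hf /is_Cderive_AbsRing hg; rewrite Cmult_comm.
exact: (is_derive_comp (V := C_NormedModule) f g _ _ _ hf hg).
Qed.

Lemma is_Cderive_inv (z : C) : z <> 0 -> is_Cderive Cinv z (- (/ (z * z)))%C.
Proof.
move=> hz; have hm := Cmod_gt_0 z; have {}hm : 0 < Cmod z by apply/hm.
apply: (@is_Cderive_quadratic _ _ _ (Cmod z / 2) (2 / Cmod z ^ 3)); first lra.
move=> w hw.
have hzw : Cmod z / 2 <= Cmod (z + w).
  have := Cmod_triangle (z + w) (- w); rewrite Cmod_opp.
  have -> : (z + w + - w = z)%C by ring.
  lra.
have nz : (z + w)%C <> 0 by move=> h; move: hzw; rewrite h Cmod_0; lra.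
have -> : (/ (z + w) - / z - w * - / (z * z) = w * w * / ((z + w) * (z * z)))%C.
  by field.
rewrite !Cmod_mult Cmod_inv; last by do !apply: Cmult_neq_0.
rewrite !Cmod_mult.
have -> : 2 / Cmod z ^ 3 * Cmod w ^ 2 = Cmod w * Cmod w * / (Cmod z / 2 * (Cmod z * Cmod z)).
  by field; lra.
apply: Rmult_le_compat_l; first by have := Cmod_ge_0 w; nra.
have hm2 : 0 < Cmod z * Cmod z by apply: Rmult_lt_0_compat.
apply: Rinv_le_contravar; first by apply: Rmult_lt_0_compat; lra.
by apply: Rmult_le_compat_r; nra.
Qed.

Lemma is_Cderive_div (f g : C -> C) (z df dg : C) :
  is_Cderive f z df -> is_Cderive g z dg -> g z <> 0 ->
  is_Cderive (fun x => f x / g x)%C z ((df * g z - f z * dg) / (g z * g z))%C.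
Proof.
move=> hf hg hz.
apply: is_Cderive_eq (is_Cderive_mult hf (is_Cderive_comp (is_Cderive_inv hz) hg)) _.
by field.
Qed.

Lemma is_Cderive_Cexp (z : C) : is_Cderive Cexp z (Cexp z).
Proof.
apply: (@is_Cderive_quadratic _ _ _ 1 (Cmod (Cexp z) * exp 1)); first lra.
move=> w hw; rewrite Cexp_plus.
have -> : (Cexp z * Cexp w - Cexp z - w * Cexp z = Cexp z * (Cexp w - 1 - w))%C by ring.
rewrite Cmod_mult Rmult_assoc; apply: Rmult_le_compat_l; first exact: Cmod_ge_0.
apply: Rle_trans (Cexp_sub1_id_bound _) _.
rewrite Rmult_comm; apply: Rmult_le_compat_r; first exact: pow2_ge_0.
by apply: exp_le; lra.
Qed.

Lemma is_Cderive_cpow (x : R) (g : C -> C) (z dg : C) :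
  is_Cderive g z dg ->
  is_Cderive (fun w => cpow x (g w)) z (RtoC (ln x) * dg * cpow x (g z))%C.
Proof.
move=> hg.
have h := @is_Cderive_comp Cexp (fun w => g w * RtoC (ln x))%C z _ _
  (is_Cderive_Cexp _) (is_Cderive_mult hg (is_Cderive_const (ln x) z)).
by apply: is_Cderive_eq h _; rewrite /cpow; ring.
Qed.

Lemma is_derive_cpow_base (s : C) (t : R) : 0 < t ->
  is_derive (V := C_R_NormedModule) (fun x => cpow x s) t (s * cpow t s / RtoC t)%C.
Proof.
move=> ht.
have := is_derive_comp (V := C_R_NormedModule) _ _ _ _ _
  (is_derive_Cexp_line s (ln t)) (is_derive_ln _ ht).
congr is_derive; rewrite -/(cpow t s).
have -> : (s * cpow t s / t = RtoC (/ t) * (s * cpow t s))%C.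
  by rewrite RtoC_inv /Cdiv; [ring | lra].
case: (s * cpow t s)%C => a b.
by apply: Cext; rewrite /Re /Im /= /scal /= /mult /=; ring.
Qed.

(** * The increments of the sequence defining zeta *)

Lemma is_derive_scal_curve (f : R -> R) (h : R -> C) (t df : R) (dh : C) :
  is_derive f t df -> is_derive (V := C_R_NormedModule) h t dh ->
  is_derive (V := C_R_NormedModule) (fun x => RtoC (f x) * h x)%C t
    (RtoC df * h t + RtoC (f t) * dh)%C.
Proof.
move=> hf hh.
have h1 : is_derive (fun x => Re (h x)) t (Re dh).
  exact: (is_derive_linear (V := R_NormedModule) is_linear_Re hh).
have h2 : is_derive (fun x => Im (h x)) t (Im dh).
  exact: (is_derive_linear (V := R_NormedModule) is_linear_Im hh).
apply: is_derive_curve.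
  apply: (is_derive_ext (fun x => f x * Re (h x))).
    by move=> x; rewrite /Re /=; ring.
  have -> : Re (df * h t + f t * dh) = df * Re (h t) + f t * Re dh.
    by rewrite /Re /=; ring.
  exact: (is_derive_mult _ _ _ _ _ hf h1 Rmult_comm).
apply: (is_derive_ext (fun x => f x * Im (h x))).
  by move=> x; rewrite /Im /=; ring.
have -> : Im (df * h t + f t * dh) = df * Im (h t) + f t * Im dh.
  by rewrite /Im /=; ring.
exact: (is_derive_mult _ _ _ _ _ hf h2 Rmult_comm).
Qed.

(** [F (m + 1) - F m] is the integral of [f (m + 1) - f t] over the unit
    interval, that is, the error of the right endpoint rule for [f]. Stating it
    through a primitive [F] makes two mean value inequalities suffice. *)
Lemma endpoint_rule_error (F f df : R -> C) (m D : R) :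
  (forall t, m <= t <= m + 1 ->
     is_derive (V := C_R_NormedModule) F t (f (m + 1)%R - f t)%C
     /\ is_derive (V := C_R_NormedModule) f t (df t) /\ Cmod (df t) <= D) ->
  Cmod (F (m + 1)%R - F m) <= D.
Proof.
move=> H.
have hm1 : m <= m + 1 by lra.
have hD : 0 <= D.
  have [_ [_ k]] := H m (conj (Rle_refl _) hm1); have := Cmod_ge_0 (df m); lra.
have := @curve_mean_value F (fun t => f (m + 1)%R - f t)%C D m (m + 1) hm1.
have -> : D * (m + 1 - m) = D by ring.
apply=> t ht; split; first by case: (H t ht).
apply: (Rle_trans _ (D * (m + 1 - t))); last by nra.
apply: (@curve_mean_value f df) => [|u hu]; first lra.
have [_ [h1 h2]] := H u ltac:(lra); by split.
Qed.

Definition zeta_incr (s : C) (n : nat) : C := (zeta_seq s n.+1 - zeta_seq s n)%C.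

(** A primitive in [x] of [M^(-s) - x^(-s)]; the increment of [zeta_seq] from
    [M - 1] to [M] is therefore the endpoint rule error for [x^(-s)]. *)
Definition zeta_prim (s : C) (M x : R) : C :=
  (cpow M (- s) * RtoC x - / (1 - s) * cpow x (1 - s))%C.

Lemma zeta_incrE (s : C) (n : nat) :
  zeta_incr s n = (zeta_prim s (INR n.+1 + 1)%R (INR n.+1 + 1)%R
                   - zeta_prim s (INR n.+1 + 1)%R (INR n.+1))%C.
Proof.
rewrite /zeta_incr /zeta_seq sum_Sn /zeta_prim -(S_INR n.+1) /plus /=.
rewrite -/(INR n.+1) -/(INR n.+2) S_INR RtoC_plus /Cdiv.
set S := sum_n _ _; ring.
Qed.

Lemma cpow_1_minus (x : R) (s : C) : 0 < x ->
  cpow x (1 - s) = (RtoC x * cpow x (- s))%C.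
Proof. by move=> hx; rewrite /Cminus cpow_plus cpow_1. Qed.

Lemma is_derive_zeta_prim (s : C) (M x : R) : s <> 1 -> 0 < x ->
  is_derive (V := C_R_NormedModule) (zeta_prim s M) x (cpow M (- s) - cpow x (- s))%C.
Proof.
move=> hs hx; rewrite /zeta_prim.
have h1s : (1 - s)%C <> 0 by move=> h; apply: hs; rewrite -[s]Cplus_0_r -h; ring.
have hx0 : RtoC x <> 0 by move=> /RtoC_inj; lra.
apply: (is_derive_minus (V := C_R_NormedModule)).
  have {2}-> : cpow M (- s) = (cpow M (- s) * 1)%C by ring.
  by apply: is_derive_Cmult_const; apply: is_derive_RtoC; exact: is_derive_id.
have -> : cpow x (- s) = (/ (1 - s) * ((1 - s) * cpow x (1 - s) / x))%C.
  by rewrite cpow_1_minus //; field.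
by apply: is_derive_Cmult_const; exact: is_derive_cpow_base.
Qed.

Lemma exp_ln_div (a t : R) : 0 < t -> exp (a * ln t) / t = exp ((a - 1) * ln t).
Proof.
move=> ht; have -> : (a - 1) * ln t = a * ln t + - ln t by ring.
by rewrite exp_plus exp_Ropp exp_ln.
Qed.

Lemma exp_ln_antitone (a x y : R) : a <= 0 -> 0 < x -> x <= y ->
  exp (a * ln y) <= exp (a * ln x).
Proof.
move=> ha hx hxy; apply: exp_le.
have : ln x <= ln y by apply: ln_le.
nra.
Qed.

Lemma Cmod_cpow_div (s : C) (t : R) : 0 < t ->
  Cmod (cpow t (- s) / t) = exp (- (1 + Re s) * ln t).
Proof.
move=> ht; rewrite Cmod_div; last by move=> /RtoC_inj; lra.
rewrite Cmod_cpow Cmod_R Rabs_pos_eq; last lra.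
by rewrite exp_ln_div //; congr (exp (_ * _)); rewrite /Re /=; ring.
Qed.

Lemma INR_S_ge1 n : 1 <= INR n.+1.
Proof. by rewrite S_INR; have := pos_INR n; lra. Qed.

(** The derivative of [t^(-s)] is [- s t^(-s-1)], so the endpoint rule error is
    one power of [n] smaller than the terms of the Dirichlet series. This gives
    convergence for every [Re s > 0]. *)
Lemma zeta_incr_bound (s : C) (n : nat) : s <> 1 -> 0 < Re s ->
  Cmod (zeta_incr s n) <= Cmod s * exp (- (1 + Re s) * ln (INR n.+1)).
Proof.
move=> hs hre; rewrite zeta_incrE; have := INR_S_ge1 n; set m := INR n.+1 => hm.
apply: (@endpoint_rule_error (zeta_prim s (m + 1)) (fun x => cpow x (- s))
  (fun t => (- s) * cpow t (- s) / t)%C) => t ht.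
split; first by apply: is_derive_zeta_prim => //; lra.
split; first by apply: is_derive_cpow_base; lra.
have -> : (- s * cpow t (- s) / t = (- s) * (cpow t (- s) / t))%C.
  by rewrite /Cdiv; ring.
rewrite Cmod_mult Cmod_opp Cmod_cpow_div; last lra.
by apply: Rmult_le_compat_l; [exact: Cmod_ge_0 | apply: exp_ln_antitone; lra].
Qed.

(** The derivative in [s] of [zeta_prim s M x]. *)
Definition zeta_prim_ds (s : C) (M x : R) : C :=
  (- (RtoC (ln M) * cpow M (- s)) * RtoC x
   - (/ ((1 - s) * (1 - s)) * cpow x (1 - s)
      - / (1 - s) * (RtoC (ln x) * cpow x (1 - s))))%C.

Lemma is_derive_zeta_prim_ds (s : C) (M x : R) : s <> 1 -> 0 < x ->
  is_derive (V := C_R_NormedModule) (zeta_prim_ds s M) x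
    (- (RtoC (ln M) * cpow M (- s)) + RtoC (ln x) * cpow x (- s))%C.
Proof.
move=> hs hx; rewrite /zeta_prim_ds.
have h1s : (1 - s)%C <> 0 by move=> h; apply: hs; rewrite -[s]Cplus_0_r -h; ring.
have hx0 : RtoC x <> 0 by move=> /RtoC_inj; lra.
have hc := is_derive_cpow_base (1 - s) hx.
have k1 := is_derive_Cmult_const (- (RtoC (ln M) * cpow M (- s)))
  (is_derive_RtoC (is_derive_id x)).
have k2 := is_derive_Cmult_const (/ ((1 - s) * (1 - s))) hc.
have k3 := is_derive_Cmult_const (/ (1 - s)) (is_derive_scal_curve (is_derive_ln _ hx) hc).
have := is_derive_minus (V := C_R_NormedModule) _ _ _ _ _ k1
  (is_derive_minus (V := C_R_NormedModule) _ _ _ _ _ k2 k3).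
congr is_derive; rewrite /minus /plus /opp /=.
change (@one _) with 1.
rewrite cpow_1_minus // RtoC_inv; last lra.
set A := cpow x _; set B := cpow M _.
change ((- (ln M * B) * 1 + - (/ ((1 - s) * (1 - s)) * ((1 - s) * (x * A) / x)
  + - (/ (1 - s) * (/ x * (x * A) + ln x * ((1 - s) * (x * A) / x)))))%C
  = (- (ln M * B) + ln x * A)%C).
by field.
Qed.

(** Powers of a logarithm [L = ln t] cost an arbitrarily small power of [t]:
    both bounds follow from [c L <= exp (c L)]. *)
Lemma log_power_absorbed (c r L : R) : 0 < c -> 0 <= r <= c -> 0 <= L ->
  L ^ 2 * exp (r * L) <= / c ^ 2 * exp (3 * c * L) /\ L <= / c * exp (3 * c * L).
Proof.
move=> hc hr hL; set E := exp (c * L).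
have hE : 1 + c * L <= E := exp_ineq1_le _.
have e3 : exp (3 * c * L) = E * E * E.
  by rewrite /E -!exp_plus; congr exp; ring.
have hr' : exp (r * L) <= E by apply: exp_le; nra.
have h0 := exp_pos (r * L).
have hi : 0 < / c by apply: Rinv_0_lt_compat.
have hL' : L <= / c * E.
  have -> : L = / c * (c * L) by field; lra.
  by apply: Rmult_le_compat_l; lra.
rewrite e3; split.
  have -> : / c ^ 2 * (E * E * E) = (/ c * E) ^ 2 * E by field; lra.
  apply: Rmult_le_compat => //; [exact: pow2_ge_0 | lra | exact: pow_incr].
have hE1 : 1 <= E by have := Rmult_le_pos c L (Rlt_le _ _ hc) hL; lra.
have : 1 <= E * E by nra.
move=> hEE; apply: Rle_trans hL' _; apply: Rmult_le_compat_l; first lra.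
nra.
Qed.

(** The second-order remainder in [w] of one increment is again an endpoint rule
    error, now for the remainder [f] of [t^(-s-w)]. Its derivative in [t]
    factors as [t^(-s-1)] times a combination of [Cexp z - 1 - z], with
    [z = - w ln t], and of [w^2 ln t]; hence it is [O(|w|^2)] with a constant
    that loses only logarithms and [t^|w|]. Spending three quarters of [Re s] on
    these losses leaves the exponent [1 + Re s / 4], which is summable. *)
Lemma zeta_incr_taylor (s w : C) (n : nat) :
  s <> 1 -> (s + w)%C <> 1 -> 0 < Re s ->
  Cmod w <= 1 -> Cmod w <= Re s / 4 ->
  let v := (zeta_prim_ds s (INR n.+1 + 1)%R (INR n.+1 + 1)%R
            - zeta_prim_ds s (INR n.+1 + 1)%R (INR n.+1))%C in
  Cmod (zeta_incr (s + w) n - zeta_incr s n - w * v)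
  <= Cmod w ^ 2 * ((Cmod s + 1) * / (Re s / 4) ^ 2 + / (Re s / 4))
     * exp (- (1 + Re s / 4) * ln (INR n.+1)).
Proof.
move=> hs hsw hre hw1 hwc v; rewrite /v !zeta_incrE {v}.
have := INR_S_ge1 n; set m := INR n.+1 => hm.
set c := Re s / 4 in hwc *; set K := (_ + / c).
pose F x := (zeta_prim (s + w) (m + 1)%R x - zeta_prim s (m + 1)%R x
  - w * zeta_prim_ds s (m + 1)%R x)%C.
pose f x := (cpow x (- (s + w)) - cpow x (- s) + w * (RtoC (ln x) * cpow x (- s)))%C.
(* df is the derivative of f with t^(-s-1) factored out *)
pose df (x : R) := (cpow x (- s) / x
  * (- (s + w) * (cpow x (- w) - 1 - (- w * ln x)) + w * w * ln x))%C.
have -> : forall a b p q x y : C, (a - b - (p - q) - w * (x - y)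
  = (a - p - w * x) - (b - q - w * y))%C by move=> *; ring.
apply: (@endpoint_rule_error F f df) => t ht.
have ht0 : 0 < t by lra.
have hx0 : RtoC t <> 0 by move=> /RtoC_inj; lra.
split.
  have := is_derive_minus (V := C_R_NormedModule) _ _ _ _ _
    (is_derive_minus (V := C_R_NormedModule) _ _ _ _ _
      (is_derive_zeta_prim (m + 1) hsw ht0) (is_derive_zeta_prim (m + 1) hs ht0))
    (is_derive_Cmult_const w (is_derive_zeta_prim_ds (m + 1) hs ht0)).
  congr is_derive; rewrite /f.
  set a := cpow _ (- (s + w)); set b := cpow _ (- s).
  set a' := cpow _ (- (s + w)); set b' := cpow _ (- s).
  change ((a - a' - (b - b') - w * (- (ln (m + 1)%R * b) + ln t * b'))%C =
    (a - b + w * (ln (m + 1)%R * b) - (a' - b' + w * (ln t * b')))%C).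
  ring.
split.
  have h1 := is_derive_cpow_base (- (s + w)) ht0.
  have h2 := is_derive_cpow_base (- s) ht0.
  have h3 := is_derive_Cmult_const w (is_derive_scal_curve (is_derive_ln _ ht0) h2).
  have := is_derive_plus (V := C_R_NormedModule) _ _ _ _ _
    (is_derive_minus (V := C_R_NormedModule) _ _ _ _ _ h1 h2) h3.
  congr is_derive; rewrite /df.
  have -> : cpow t (- (s + w)) = (cpow t (- s) * cpow t (- w))%C.
    by rewrite -cpow_plus; congr cpow; ring.
  rewrite RtoC_inv; last lra.
  set a := cpow _ (- s); set b := cpow _ (- w).
  change ((- (s + w) * (a * b) / t - - s * a / t + w * (/ t * a + ln t * (- s * a / t)))%C
    = (a / t * (- (s + w) * (b - 1 - - w * ln t) + w * w * ln t))%C).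
  by field.
rewrite /df Cmod_mult Cmod_cpow_div //.
have hL : 0 <= ln t by rewrite -ln_1; apply: ln_le; lra.
set L := ln t in hL *.
have hw0 := Cmod_ge_0 w; have hs0 := Cmod_ge_0 s.
have hc : 0 < c by rewrite /c; lra.
have [k1 k2] := @log_power_absorbed c (Cmod w) L hc (conj hw0 hwc) hL.
have hB : Cmod (- (s + w) * (cpow t (- w) - 1 - (- w * L)) + w * w * L)
    <= Cmod w ^ 2 * K * exp (3 * c * L).
  apply: Rle_trans (Cmod_triangle _ _) _.
  rewrite !Cmod_mult Cmod_opp Cmod_R (Rabs_pos_eq L) //.
  have := Cexp_sub1_id_bound (- w * L); rewrite -/(cpow t (- w)).
  rewrite Cmod_mult Cmod_opp Cmod_R (Rabs_pos_eq L) //.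
  set R1 := Cmod (_ - _ - _) => hR.
  have hsw' : Cmod (s + w) <= Cmod s + 1.
    by apply: Rle_trans (Cmod_triangle _ _) _; lra.
  have hR1 : R1 <= Cmod w ^ 2 * (/ c ^ 2 * exp (3 * c * L)).
    apply: Rle_trans hR _.
    have -> : (Cmod w * L) ^ 2 * exp (Cmod w * L) = Cmod w ^ 2 * (L ^ 2 * exp (Cmod w * L)) by ring.
    by apply: Rmult_le_compat_l => //; exact: pow2_ge_0.
  have h1 : Cmod (s + w) * R1 <= (Cmod s + 1) * (Cmod w ^ 2 * (/ c ^ 2 * exp (3 * c * L))).
    apply: Rmult_le_compat => //; exact: Cmod_ge_0.
  have h2 : Cmod w * Cmod w * L <= Cmod w ^ 2 * (/ c * exp (3 * c * L)).
    have -> : Cmod w * Cmod w = Cmod w ^ 2 by ring.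
    by apply: Rmult_le_compat_l => //; exact: pow2_ge_0.
  apply: Rle_trans (Rplus_le_compat _ _ _ _ h1 h2) _.
  by apply: Req_le; rewrite /K; ring.
have hK : 0 <= Cmod w ^ 2 * K.
  apply: Rmult_le_pos; first exact: pow2_ge_0.
  have h1 : 0 < / c by apply: Rinv_0_lt_compat.
  have h2 : 0 < / c ^ 2 by apply: Rinv_0_lt_compat; apply: pow_lt.
  rewrite /K; nra.
apply: Rle_trans (Rmult_le_compat_l _ _ _ (Rlt_le _ _ (exp_pos _)) hB) _.
have -> : exp (- (1 + Re s) * L) * (Cmod w ^ 2 * K * exp (3 * c * L))
  = Cmod w ^ 2 * K * exp (- (1 + c) * L).
  have -> : - (1 + c) * L = - (1 + Re s) * L + 3 * c * L by rewrite /c; field.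
  by rewrite exp_plus; ring.
apply: Rmult_le_compat_l => //.
by apply: exp_ln_antitone; lra.
Qed.

(** * Zeta on the right half-plane *)

Notation is_Cseries := (is_series (K := C_AbsRing) (V := C_NormedModule)).

Lemma is_Cseries_bound (a : nat -> C) (l : C) (b : nat -> R) (B : R) :
  is_Cseries a l -> (forall n, Cmod (a n) <= b n) ->
  (forall n, sum_n b n <= B) -> Cmod l <= B.
Proof.
move=> ha hab hB.
have h1 : is_lim_seq (fun n => Cmod (sum_n (G := C_NormedModule) a n)) (Cmod l).
  exact: (filterlim_comp _ _ _ _ _ _ _ _ ha (filterlim_norm (V := C_NormedModule) l)).
have h2 := is_lim_seq_const B.
apply: (is_lim_seq_le _ _ _ _ _ h1 h2) => n.
apply: Rle_trans (hB n).
apply: Rle_trans (norm_sum_n_m (V := C_NormedModule) a 0 n) _.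
by apply: sum_n_m_le => k; exact: hab.
Qed.

Lemma ex_Cseries_le (a : nat -> C) (b : nat -> R) :
  (forall n, Cmod (a n) <= b n) -> ex_series b ->
  exists l, is_Cseries a l.
Proof. exact: (ex_series_le (V := C_CompleteNormedModule)). Qed.

(** The explicit constant matters: it decides on how large a disc around the
    pole [zeta] is shown to have no zero. *)
Lemma sum_Rpow_le (a : R) (n : nat) : 0 < a ->
  sum_n (fun n => exp (- (1 + a) * ln (INR n.+1))) n <= 1 + / a.
Proof.
move=> ha; pose b n := exp (- a * ln (INR n.+1)).
suff H : sum_n (fun n => exp (- (1 + a) * ln (INR n.+1))) n <= 1 + / a * (1 - b n).
  apply: Rle_trans H _; have := exp_pos (- a * ln (INR n.+1)); rewrite -/(b n) => hb.
  have := Rinv_0_lt_compat _ ha; nra.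
elim: n => [|n IH].
  by rewrite sum_O /b /= ln_1 !Rmult_0_r exp_0; lra.
rewrite sum_Sn /plus /=; apply: Rle_trans (Rplus_le_compat_r _ _ _ IH) _.
have := cpow_real_step ha (INR_S_ge1 n); rewrite -S_INR -/(b n) -/(b n.+1) => H.
rewrite -/(INR n.+2); set x := exp _ in H *.
have -> : x = / a * (a * x) by field; lra.
have := Rmult_le_compat_l (/ a) _ _ (Rlt_le _ _ (Rinv_0_lt_compat _ ha)) H.
lra.
Qed.

Lemma is_series_zeta_incr (s : C) : s <> 1 -> 0 < Re s ->
  is_Cseries (zeta_incr s) (zeta s - zeta_seq s 0)%C.
Proof.
move=> hs hre.
have [l hl] : exists l, is_Cseries (zeta_incr s) l.
  apply: (@ex_Cseries_le _ (fun n => Cmod s * exp (- (1 + Re s) * ln (INR n.+1)))) => [n|].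
    exact: zeta_incr_bound.
  exact: ex_series_scal_l (ex_series_Rpow hre).
suff -> : zeta s = (zeta_seq s 0 + l)%C.
  by have -> : (zeta_seq s 0 + l - zeta_seq s 0)%C = l by ring.
have E n : zeta_seq s n.+1 = (zeta_seq s 0 + sum_n (G := C_NormedModule) (zeta_incr s) n)%C.
  elim: n => [|n IH]; first by rewrite sum_O /zeta_incr; ring.
  by rewrite sum_Sn /plus /= Cplus_assoc -IH /zeta_incr; ring.
have h0 : filterlim (fun n => zeta_seq s n.+1) eventually
    (locally (T := C_UniformSpace) (zeta_seq s 0 + l)%C).
  apply: (filterlim_ext _ _ (fun n => esym (E n))).
  exact: (filterlim_comp_2 _ _ _ (filterlim_const (T := C_UniformSpace) (zeta_seq s 0)) hl
          (filterlim_plus (V := C_NormedModule) (zeta_seq s 0) l)).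
set L := (zeta_seq s 0 + l)%C in h0 *.
have hR : is_lim_seq (fun n => Re (zeta_seq s n)) (Re L).
  apply/is_lim_seq_incr_1 => P [eps He]; have [N HN] := h0 _ (locally_ball _ eps).
  by exists N => n /HN [h _]; apply: He.
have hI : is_lim_seq (fun n => Im (zeta_seq s n)) (Im L).
  apply/is_lim_seq_incr_1 => P [eps He]; have [N HN] := h0 _ (locally_ball _ eps).
  by exists N => n /HN [_ h]; apply: He.
by rewrite /zeta (is_lim_seq_unique _ _ hR) (is_lim_seq_unique _ _ hI) -surjective_pairing.
Qed.

Lemma zeta_seq_0 (s : C) : zeta_seq s 0 = (1 - / (1 - s))%C.
Proof. by rewrite /zeta_seq sum_O !cpow_base1 /Cdiv; ring. Qed.

(** Since [- / (1 - s)] is the principal part of [zeta] at 1, this says that the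
    regular part is bounded near the pole. *)
Lemma zeta_pole_bound (s : C) : s <> 1 -> 0 < Re s ->
  Cmod (zeta s + / (1 - s)) <= 1 + Cmod s * (1 + / Re s).
Proof.
move=> hs hre.
have -> : (zeta s + / (1 - s) = 1 + (zeta s - zeta_seq s 0))%C.
  by rewrite zeta_seq_0; ring.
apply: Rle_trans (Cmod_triangle _ _) _; rewrite Cmod_1; apply: Rplus_le_compat_l.
apply: (is_Cseries_bound (is_series_zeta_incr hs hre)
  (fun n => zeta_incr_bound n hs hre)) => n.
have -> : sum_n (fun n => Cmod s * exp (- (1 + Re s) * ln (INR n.+1))) n
  = Cmod s * sum_n (fun n => exp (- (1 + Re s) * ln (INR n.+1))) n.
  exact: (sum_n_mult_l (K := R_AbsRing)).
by apply: Rmult_le_compat_l; [exact: Cmod_ge_0 | exact: sum_Rpow_le].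
Qed.

Lemma Cplus1_neq1 (w : C) : w <> 0 -> (1 + w)%C <> 1.
Proof.
move=> hw h; apply: hw.
have -> : w = (1 + w - 1)%C by ring.
by rewrite h; ring.
Qed.

(** For [|w| <= 1/7] the previous bound is at most
    [1 + 8/7 (1 + 7/6) = 73/21 < 4]. Since [4 < 7 <= 1/|w|], the pole dominates
    the regular part, which excludes zeros. *)
Lemma zeta_near_pole (w : C) : w <> 0 -> Cmod w <= / 7 ->
  Cmod (zeta (1 + w) - / w) <= 4.
Proof.
move=> hw0 hw.
have hre : 6 / 7 <= Re (1 + w).
  have := re_le_Cmod w; have := Rle_abs (- Re w); rewrite Rabs_Ropp.
  have -> : Re (1 + w) = 1 + Re w by []. lra.
have hs := Cplus1_neq1 hw0.
have hw' : (1 - (1 + w) = - w)%C by ring.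
have e : (/ (1 - (1 + w)) = - / w)%C by rewrite hw'; field.
have hre0 : 0 < Re (1 + w) by lra.
have := zeta_pole_bound hs hre0; rewrite e => H; apply: Rle_trans H _.
have h1 : Cmod (1 + w) <= 8 / 7.
  by apply: Rle_trans (Cmod_triangle _ _) _; rewrite Cmod_1; lra.
have h2 : / Re (1 + w) <= 7 / 6.
  have -> : 7 / 6 = / (6 / 7) by field.
  by apply: Rinv_le_contravar; lra.
have := Cmod_ge_0 (1 + w).
have : 0 < / Re (1 + w) by apply: Rinv_0_lt_compat; lra.
nra.
Qed.

Lemma zeta_near_pole_lower (w : C) : w <> 0 -> Cmod w <= / 7 ->
  / Cmod w - 4 <= Cmod (zeta (1 + w)).
Proof.
move=> hw0 hw; have := zeta_near_pole hw0 hw; rewrite -(Cmod_inv _ hw0).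
have := Cmod_triangle (zeta (1 + w)) (- (zeta (1 + w) - / w)).
have -> : (zeta (1 + w) + - (zeta (1 + w) - / w) = / w)%C by ring.
by rewrite Cmod_opp; lra.
Qed.

Lemma zeta_neq0_near_pole (w : C) : w <> 0 -> Cmod w <= / 7 -> zeta (1 + w) <> 0.
Proof.
move=> hw0 hw hz; have := zeta_near_pole_lower hw0 hw; rewrite hz Cmod_0.
have hm : 0 < Cmod w by apply/Cmod_gt_0.
have : 7 <= / Cmod w by rewrite -(Rinv_inv 7); apply: Rinv_le_contravar.
lra.
Qed.

Lemma inv_zeta_1 : inv_zeta 1 = 0.
Proof. by rewrite /inv_zeta; case: (Ceq_dec 1 1). Qed.

Lemma inv_zeta_neq1 (s : C) : s <> 1 -> inv_zeta s = (/ zeta s)%C.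
Proof. by rewrite /inv_zeta; case: (Ceq_dec s 1). Qed.

(** With [zeta (1 + w) = 1/w + g] and [|g| <= 4], the difference
    [1 / zeta (1 + w) - w = - w g / zeta (1 + w)] is [O(|w|^2)], because
    [zeta (1 + w)] has modulus at least [1 / (2 |w|)] for [|w| <= 1/8]. *)
Lemma is_Cderive_inv_zeta : is_Cderive inv_zeta (RtoC 1) (RtoC 1).
Proof.
apply: (@is_Cderive_quadratic _ _ _ (/ 8) 8); first lra.
move=> w hw; rewrite inv_zeta_1.
case: (Ceq_dec w 0) => [->|hw0].
  rewrite Cplus_0_r inv_zeta_1.
  have -> : (0 - 0 - 0 * 1)%C = 0 by ring.
  by rewrite Cmod_0; lra.
rewrite inv_zeta_neq1; last exact: Cplus1_neq1.
have hw7 : Cmod w <= / 7 by lra.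
have hz := zeta_neq0_near_pole hw0 hw7.
have hm : 0 < Cmod w by apply/Cmod_gt_0.
have -> : (/ zeta (1 + w) - 0 - w * 1 = - w * (zeta (1 + w) - / w) * / zeta (1 + w))%C.
  by field.
rewrite !Cmod_mult Cmod_opp Cmod_inv //.
have hlow : / (2 * Cmod w) <= Cmod (zeta (1 + w)).
  apply: Rle_trans (zeta_near_pole_lower hw0 hw7).
  have : 8 <= / Cmod w by rewrite -(Rinv_inv 8); apply: Rinv_le_contravar; lra.
  by rewrite Rinv_mult; lra.
have hup : / Cmod (zeta (1 + w)) <= 2 * Cmod w.
  rewrite -(Rinv_inv (2 * Cmod w)); apply: Rinv_le_contravar => //.
  by apply: Rinv_0_lt_compat; lra.
have h4 := zeta_near_pole hw0 hw7.
have -> : 8 * Cmod w ^ 2 = Cmod w * 4 * (2 * Cmod w) by ring.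
apply: Rmult_le_compat => //.
- by apply: Rmult_le_pos; exact: Cmod_ge_0.
- by apply/Rlt_le/Rinv_0_lt_compat; apply/Cmod_gt_0.
by apply: Rmult_le_compat_l; lra.
Qed.

(** Summing the second-order Taylor bounds of the increments differentiates the
    series of the regular part term by term. *)
Lemma ex_Cderive_zeta (s : C) : s <> 1 -> 0 < Re s ->
  exists l, is_Cderive zeta s l.
Proof.
move=> hs hre; pose G s := (zeta s - zeta_seq s 0)%C.
have h1s : (1 - s)%C <> 0 by move=> h; apply: hs; rewrite -[s]Cplus_0_r -h; ring.
have hm : 0 < Cmod (1 - s) by apply/Cmod_gt_0.
pose d := Rmin (Rmin 1 (Re s / 4)) (Cmod (1 - s)).
have hd : 0 < d by do !apply: Rmin_pos; lra.
have hnear w : Cmod w < d -> [/\ (s + w)%C <> 1, 0 < Re (s + w), Cmod w <= 1 & Cmod w <= Re s / 4].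
  move=> hw.
  have h1 := Rlt_le_trans _ _ _ hw (Rmin_r _ _).
  have h2 := Rlt_le_trans _ _ _ hw (Rmin_l _ _).
  have h3 := Rlt_le_trans _ _ _ h2 (Rmin_l _ _).
  have h4 := Rlt_le_trans _ _ _ h2 (Rmin_r _ _).
  split; try lra.
    have ew : (s + w - s = w)%C by ring.
    by move=> e; move: h1; rewrite -e ew; lra.
  have -> : Re (s + w) = Re s + Re w by [].
  by have := re_le_Cmod w; have := Rle_abs (- Re w); rewrite Rabs_Ropp; lra.
pose v n := (zeta_prim_ds s (INR n.+1 + 1)%R (INR n.+1 + 1)%R
            - zeta_prim_ds s (INR n.+1 + 1)%R (INR n.+1))%C.
pose K := (Cmod s + 1) * / (Re s / 4) ^ 2 + / (Re s / 4).
pose b (w : C) n := Cmod w ^ 2 * K * exp (- (1 + Re s / 4) * ln (INR n.+1)).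
pose r w n := (zeta_incr (s + w) n - zeta_incr s n - w * v n)%C.
have hr w : Cmod w < d -> forall n, Cmod (r w n) <= b w n.
  by move=> /hnear [h1 h2 h3 h4] n; exact: zeta_incr_taylor.
have hre4 : 0 < Re s / 4 by lra.
have exb w : ex_series (b w) by exact: ex_series_scal_l (ex_series_Rpow hre4).
(* the derivatives of the terms are summable because all other terms of one
   first-order expansion are *)
have [l hl] : exists l, is_Cseries v l.
  pose w0 : C := RtoC (d / 2).
  have hw0 : Cmod w0 < d by rewrite Cmod_R Rabs_pos_eq; lra.
  have [h1 h2 _ _] := hnear _ hw0.
  have [R0 hR0] := ex_Cseries_le (hr _ hw0) (exb _).
  have k := is_series_scal (/ w0)%C _ _ (is_series_minus _ _ _ _
    (is_series_minus _ _ _ _ (is_series_zeta_incr h1 h2) (is_series_zeta_incr hs hre)) hR0).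
  eexists; apply: is_series_ext k => n; rewrite /r.
  have nz : w0 <> 0 by move=> /RtoC_inj; lra.
  change ((/ w0 * ((zeta_incr (s + w0) n - zeta_incr s n)
    - (zeta_incr (s + w0) n - zeta_incr s n - w0 * v n)))%C = v n).
  by field.
have hG : is_Cderive G s l.
  apply: (@is_Cderive_quadratic _ _ _ d (K * (1 + / (Re s / 4)))) => // w hw.
  have [h1 h2 _ _] := hnear _ hw.
  have k := is_series_minus _ _ _ _
    (is_series_minus _ _ _ _ (is_series_zeta_incr h1 h2) (is_series_zeta_incr hs hre))
    (is_series_scal w _ _ hl).
  apply: (is_Cseries_bound k (hr _ hw)) => n.
  have -> : sum_n (b w) n = Cmod w ^ 2 * K *
      sum_n (fun n => exp (- (1 + Re s / 4) * ln (INR n.+1))) n.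
    exact: (sum_n_mult_l (K := R_AbsRing)).
  have -> : K * (1 + / (Re s / 4)) * Cmod w ^ 2 = Cmod w ^ 2 * K * (1 + / (Re s / 4)) by ring.
  apply: Rmult_le_compat_l; last exact: sum_Rpow_le.
  have p1 : 0 < / (Re s / 4) by apply: Rinv_0_lt_compat.
  have p2 : 0 < / (Re s / 4) ^ 2 by apply: Rinv_0_lt_compat; apply: pow_lt.
  apply: Rmult_le_pos; first exact: pow2_ge_0.
  by have := Cmod_ge_0 s; rewrite /K; nra.
have hp := is_Cderive_minus (is_Cderive_const 1 s)
  (@is_Cderive_comp Cinv (fun z => 1 - z)%C s _ _ (is_Cderive_inv h1s)
    (is_Cderive_minus (is_Cderive_const 1 s) (is_Cderive_id s))).
have := is_Cderive_plus hG hp.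
have E (z : C) : (G z + (1 - / (1 - z)))%C = zeta z by rewrite /G zeta_seq_0; ring.
by move=> k; eexists; exact: is_derive_ext E k.
Qed.

(** * Complex conjugation *)

Lemma Cconj_RtoC (x : R) : Cconj (RtoC x) = RtoC x.
Proof. by rewrite /Cconj /= Ropp_0. Qed.

Lemma Cconj_inv (z : C) : Cconj (/ z) = (/ Cconj z)%C.
Proof.
case: (Ceq_dec z 0) => [->|/Cinv_conj //].
have e : (/ 0)%C = 0 by apply: Cext; rewrite /Re /Im /= /Rdiv; ring.
by rewrite Cconj_RtoC e Cconj_RtoC.
Qed.

Lemma Cconj_div (z w : C) : Cconj (z / w) = (Cconj z / Cconj w)%C.
Proof. by rewrite /Cdiv Cmult_conj Cconj_inv. Qed.

Lemma zeta_conj (s : C) : zeta (Cconj s) = Cconj (zeta s).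
Proof.
have E N : zeta_seq (Cconj s) N = Cconj (zeta_seq s N).
  rewrite /zeta_seq Cminus_conj Cconj_div cpow_conj !Cminus_conj Cconj_RtoC.
  congr Cminus; elim: N => [|N IH]; first by rewrite !sum_O cpow_conj Copp_conj.
  by rewrite !sum_Sn IH /plus /= Cplus_conj cpow_conj Copp_conj.
rewrite /zeta /Cconj; congr (_, _).
  by congr real; apply: Lim_seq_ext => N; rewrite E.
rewrite [RHS]/= -Rbar_opp_real -Lim_seq_opp; congr real; apply: Lim_seq_ext => N.
by rewrite E.
Qed.

Lemma is_Cderive_conj (f : C -> C) (z l : C) :
  is_Cderive f z l -> is_Cderive (fun w => Cconj (f (Cconj w))) (Cconj z) (Cconj l).
Proof.
move=> [_ h]; split; first exact: is_linear_scal_l.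
move=> x /is_filter_lim_locally_unique <- eps.
have [d hd] := h z (fun P hP => hP) eps.
exists d => y hy; have hz : ball (M := AbsRing_UniformSpace C_AbsRing) z d (Cconj y).
  move: hy; rewrite /ball /= /AbsRing_ball /abs /minus /plus /opp /= -(Cmod_conj (Cconj y + _)).
  by rewrite Cplus_conj Copp_conj Cconj_conj.
have := hd _ hz.
change (Cmod (f (Cconj y) - f z - (Cconj y - z) * l) <= eps * Cmod (Cconj y - z) ->
  Cmod (Cconj (f (Cconj y)) - Cconj (f (Cconj (Cconj z))) - (y - Cconj z) * Cconj l)
  <= eps * Cmod (y - Cconj z)).
rewrite Cconj_conj -(Cmod_conj (f _ - _ - _)) -(Cmod_conj (Cconj y - z)).
by rewrite !Cminus_conj Cmult_conj Cminus_conj Cconj_conj.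
Qed.

Lemma C_derive_zeta_conj (s : C) : s <> 1 -> 0 < Re s ->
  C_derive zeta (Cconj s) = Cconj (C_derive zeta s).
Proof.
move=> hs hre; have [l hl] := ex_Cderive_zeta hs hre.
rewrite (is_C_derive_unique _ _ _ hl); apply: is_C_derive_unique.
apply: is_derive_ext (is_Cderive_conj hl) => z.
by rewrite zeta_conj Cconj_conj.
Qed.

(** * The mean over (0, T] *)

Lemma filterlim_cpow_0 (s : C) : 0 < Re s ->
  filterlim (fun x => cpow x s) (at_right 0) (locally (T := C_UniformSpace) (RtoC 0)).
Proof.
move=> hs P [eps He].
have h1 : filterlim (fun x => Re s * ln x) (at_right 0) (Rbar_locally m_infty).
  have h := filterlim_comp _ _ _ _ _ _ _ _ is_lim_ln_0 (filterlim_Rbar_mult_l (Re s) m_infty).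
  have e : Rbar_mult (Re s) m_infty = m_infty.
    rewrite /Rbar_mult /=; case: Rle_dec => k; last by exfalso; lra.
    by case: Rle_lt_or_eq_dec => // k'; exfalso; lra.
  by rewrite e in h.
have h2 := filterlim_comp _ _ _ _ _ _ _ _ h1 is_lim_exp_m.
have h3 : at_right 0 (fun x => ball (0 : R) eps (exp (Re s * ln x))).
  exact: h2 _ (locally_ball (0 : R) eps).
change (at_right 0 (fun x => P (cpow x s))); apply: filter_imp h3 => x hx.
apply: He; apply: C_NormedModule_mixin_compat1.
have := hx; rewrite /ball /= /AbsRing_ball /abs /minus /plus /opp /=.
rewrite Ropp_0 Rplus_0_r Rabs_pos_eq; last exact/Rlt_le/exp_pos.
by rewrite Copp_0 Cplus_0_r Cmod_cpow.
Qed.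

(** The antiderivative [A t + E t^(z+1) / (z+1)] tends to 0 at 0 because
    [Re (z + 1) > 0], so only its value at [T] remains. *)
Lemma is_RInt_gen_cpow (A E z : C) (T : R) : 0 < T -> -1 < Re z ->
  is_RInt_gen (V := C_R_NormedModule) (fun t => A + E * cpow t z)%C
    (at_right 0) (at_point T)
    (A * RtoC T + E / (z + 1) * cpow T (z + 1))%C.
Proof.
move=> hT hz.
have hz1 : (z + 1)%C <> 0 by move=> /(f_equal Re); rewrite /Re /=; move: hz; rewrite /Re; lra.
pose f t := (A + E * cpow t z)%C.
pose F t := (A * RtoC t + E / (z + 1) * cpow t (z + 1))%C.
have hF t : 0 < t -> is_derive (V := C_R_NormedModule) F t (f t).
  move=> ht.
  have := is_derive_plus (V := C_R_NormedModule) _ _ _ _ _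
    (is_derive_Cmult_const A (is_derive_RtoC (is_derive_id t)))
    (is_derive_Cmult_const (E / (z + 1)) (is_derive_cpow_base (z + 1) ht)).
  congr is_derive; rewrite cpow_plus cpow_1 //.
  have ht0 : RtoC t <> 0 by move=> /RtoC_inj; lra.
  change ((A * 1 + E / (z + 1) * ((z + 1) * (cpow t z * t) / t))%C = f t).
  by rewrite /f; field.
have hcont t : 0 < t -> continuous (U := C_R_NormedModule) f t.
  move=> ht; apply: (ex_derive_continuous (V := C_R_NormedModule)).
  eexists; apply: (is_derive_plus (V := C_R_NormedModule)); first exact: is_derive_const.
  exact: is_derive_Cmult_const (is_derive_cpow_base z ht).
have hF0 : filterlim F (at_right 0) (locally (T := C_UniformSpace) (RtoC 0)).
  have h1 := filterlim_comp _ _ _ _ _ _ _ _ (@filterlim_cpow_0 1 Rlt_0_1)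
    (filterlim_scal_r (V := C_NormedModule) A (RtoC 0)).
  have hz' : 0 < Re (z + 1) by move: hz; rewrite /Re /=; lra.
  have h2 := filterlim_comp _ _ _ _ _ _ _ _ (filterlim_cpow_0 hz')
    (filterlim_scal_r (V := C_NormedModule) (E / (z + 1))%C (RtoC 0)).
  have h3 := filterlim_comp_2 _ _ _ h1 h2 (filterlim_plus (V := C_NormedModule) _ _).
  have e : RtoC 0 = plus (scal A (RtoC 0 : C_NormedModule)) (scal (E / (z + 1))%C (RtoC 0)).
    change (RtoC 0 = (A * 0 + E / (z + 1) * 0)%C); ring.
  rewrite e; refine (filterlim_ext_loc _ _ _ (h3 _)).
  exists (mkposreal _ Rlt_0_1) => y _ hy.
  by rewrite cpow_1.
move=> P hP.
have hlim : filterlim (fun x => F T - F x)%C (at_right 0) (locally (T := C_UniformSpace) (F T)).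
  have h := filterlim_comp_2 _ _ _ (filterlim_const (T := C_UniformSpace) (F T))
    (filterlim_comp _ _ _ _ _ _ _ _ hF0 (filterlim_opp (V := C_NormedModule) (RtoC 0)))
    (filterlim_plus (V := C_NormedModule) (F T) (Copp 0)).
  have e : F T = plus (F T : C_NormedModule) (Copp 0).
    change (F T = F T + - 0)%C; ring.
  have h' := h _; rewrite -e in h'; exact: h'.
apply: (Filter_prod _ _ _ (fun x => 0 < x < T /\ P (F T - F x)%C) (fun y => y = T)) => //.
  have hpos : at_right 0 (fun x => 0 < x < T).
    exists (mkposreal _ hT) => y; rewrite /ball /= /AbsRing_ball /abs /minus /plus /opp /= => hy hy0.
    by split => //; have := Rle_abs (y + - 0); lra.
  exact: (filter_and _ _ hpos (hlim _ hP)).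
move=> x y [hx hPx] -> /=; exists (F T - F x)%C; split => //.
by apply: (is_RInt_derive (V := C_R_CompleteNormedModule) F f);
  rewrite Rmin_left ?Rmax_right; try lra; move=> t ht; [apply: hF | apply: hcont]; lra.
Qed.

Lemma is_RInt_gen_integrand (alpha gamma : C) (h k : nat) (T : R) : 0 < T ->
  Re (Cconj alpha + gamma) < 1 ->
  let z := (- Cconj alpha - gamma)%C in
  is_RInt_gen (V := C_R_NormedModule) (integrand alpha h k gamma)
    (at_right 0) (at_point T)
    (Zterm (Cconj alpha) gamma h k * RtoC T
     + cpow (/ (2 * PI)) z * Zterm (- gamma) (- Cconj alpha) h k / (z + 1) * cpow T (z + 1))%C.
Proof.
move=> hT hre z.
have hz : -1 < Re z by move: hre; rewrite /z /Re /=; lra.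
set A := Zterm _ gamma h k; set B := Zterm _ (- Cconj alpha) h k.
have H := @is_RInt_gen_cpow A (cpow (/ (2 * PI)) z * B) z T hT hz.
refine (@is_RInt_gen_ext C_R_NormedModule _ _ _ _ _ _ _ _ H).
have h2pi : 0 < / (2 * PI) by apply: Rinv_0_lt_compat; have := PI_RGT_0; lra.
apply: (Filter_prod _ _ _ (fun x => 0 < x) (fun y => y = T)) => //.
  by exists (mkposreal _ Rlt_0_1).
move=> x y hx -> t /= [ht _].
have ht0 : 0 < t by apply: Rlt_trans ht; apply: Rmin_glb_lt.
have e : integrand alpha h k gamma t = (A + cpow (/ (2 * PI)) z * B * cpow t z)%C.
  by rewrite /integrand -/z -/A -/B /Rdiv cpow_mult //; ring.
by rewrite e.
Qed.

(** * Products over the primes dividing k *)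

Notation "\Cprod_ ( p <- ps ) F" := (\big[Cmult/RtoC 1]_(p <- ps) F%C)
  (at level 36, F at level 36, p, ps at level 50).

Lemma Cprod_mult (ps : seq nat) (f g : nat -> C) :
  \Cprod_(p <- ps) (f p * g p) = (\Cprod_(p <- ps) f p * \Cprod_(p <- ps) g p)%C.
Proof.
elim: ps => [|p ps IH]; first by rewrite !big_nil Cmult_1_l.
by rewrite !big_cons IH; ring.
Qed.

Lemma Cprod_conj (ps : seq nat) (f : nat -> C) :
  Cconj (\Cprod_(p <- ps) f p) = \Cprod_(p <- ps) Cconj (f p).
Proof.
elim: ps => [|p ps IH]; first by rewrite !big_nil Cconj_RtoC.
by rewrite !big_cons Cmult_conj IH.
Qed.

Lemma ex_Cderive_Cprod (ps : seq nat) (f : nat -> C -> C) (z : C) :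
  (forall p, p \in ps -> exists l, is_Cderive (f p) z l) ->
  exists l, is_Cderive (fun w => \Cprod_(p <- ps) f p w) z l.
Proof.
elim: ps => [|p ps IH] H.
  exists (RtoC 0); apply: is_derive_ext (is_Cderive_const 1 z) => w.
  by rewrite big_nil.
have [l1 h1] := H p (mem_head _ _).
have [|l2 h2] := IH; first by move=> q hq; apply: H; rewrite in_cons hq orbT.
eexists; apply: is_derive_ext (is_Cderive_mult h1 h2) => w.
by rewrite big_cons.
Qed.

(** Each factor vanishes at the point, so only a product of a single factor has
    a simple zero there. *)
Lemma is_Cderive_Cprod_zeros (ps : seq nat) (f : nat -> C -> C) (df : nat -> C) (z : C) :
  (forall p, f p z = 0) -> (forall p, is_Cderive (f p) z (df p)) ->
  is_Cderive (fun w => \Cprod_(p <- ps) f p w) z (if ps is [:: p] then df p else RtoC 0).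
Proof.
move=> f0 hf; case: ps => [|p ps].
  apply: is_derive_ext (is_Cderive_const 1 z) => w.
  by rewrite big_nil.
have [l hl] : exists l, is_Cderive (fun w => \Cprod_(p <- ps) f p w) z l.
  by apply: ex_Cderive_Cprod => q _; exists (df q).
apply: is_derive_ext => [w|].
  by rewrite big_cons.
apply: is_Cderive_eq (is_Cderive_mult (hf p) hl) _; rewrite f0.
case: ps {hl} => [|q ps]; first by rewrite big_nil; ring.
by rewrite big_cons f0; ring.
Qed.

Lemma cpow_prime_neq1 (p : nat) (s : C) : (1 < p)%nat -> 0 < Re s ->
  (1 - cpow (INR p) (- s))%C <> 0.
Proof.
move=> hp hs h.
have hln : 0 < ln (INR p).
  by rewrite -ln_1; apply: ln_increasing; [lra | apply: (lt_INR 1); apply/ltP].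
have : Cmod (cpow (INR p) (- s)) < 1.
  rewrite Cmod_cpow -exp_0; apply: exp_increasing.
  have -> : Re (- s) = - Re s by [].
  by have := Rmult_lt_0_compat _ _ hs hln; lra.
have -> : cpow (INR p) (- s) = 1.
  by rewrite -[LHS]Cplus_0_l -h; ring.
by rewrite Cmod_1; lra.
Qed.

Lemma INR_muln (m n : nat) : INR (muln m n) = INR m * INR n.
Proof. exact: mult_INR. Qed.

(** Euler's product: a prime power [p^e] contributes [p^e] to [k] and
    [(p - 1) p^(e-1)] to the totient. *)
Lemma totient_ratio (k : nat) : (0 < k)%nat ->
  RtoC (INR k / INR (totient k)) = \Cprod_(p <- primes k) (/ (1 - cpow (INR p) (- (1)))).
Proof.
move=> hk; rewrite {1}[k]prod_prime_decomp // totientE // prime_decompE big_map /=.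
have : all (fun p => (1 < p)%nat && (0 < logn p k)%nat) (primes k).
  apply/allP => p hp; rewrite logn_gt0 hp andbT.
  by move: hp; rewrite mem_primes => /andP [/prime_gt1].
elim: (primes k) => [|p ps IH] /=.
  by rewrite !big_nil Rdiv_1_r.
case/andP => /andP [hp he] /IH {}IH; rewrite !big_cons -IH {IH}.
set a := \big[_/_]_(_ <- ps) _; set b := \big[_/_]_(_ <- ps) _.
have hp1 : 1 < INR p by apply: (lt_INR 1); apply/ltP.
have hp0 : p = p.-1.+1 by rewrite prednK // ltnW.
have he0 : logn p k = (logn p k).-1.+1 by rewrite prednK.
rewrite {1}he0 expnS !INR_muln.
have hE : 0 < INR (expn p (logn p k).-1).
  by apply: (lt_INR 0); apply/ltP; rewrite expn_gt0 ltnW.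
set E := INR (expn _ _) in hE *.
have -> : INR p.-1 = INR p - 1 by rewrite {2}hp0 S_INR; ring.
rewrite cpow_opp cpow_1; last lra.
rewrite -RtoC_inv; last lra.
rewrite -RtoC_minus -RtoC_inv; last first.
  have : / INR p < 1 by rewrite -Rinv_1; apply: Rinv_lt_contravar; lra.
  lra.
rewrite -RtoC_mult; congr RtoC.
rewrite /Rdiv !Rinv_mult.
have -> : / (1 - / INR p) = INR p * / (INR p - 1) by field; lra.
rewrite -[RHS]Rmult_1_r -(Rinv_r E); last lra.
ring.
Qed.

(** * The derivatives of the two terms *)

Lemma vonMangoldt_primes (k : nat) :
  vonMangoldt k = if primes k is [:: p] then ln (INR p) else 0.
Proof.
rewrite /vonMangoldt /primes.
by case: (prime_decomp k) => [|[p e] [|[q e'] l]].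
Qed.

Lemma primes_nil (k : nat) : (0 < k)%nat -> (primes k == [::]) = (k == 1%nat).
Proof. by case: k => [|[|k]] // _; rewrite primes_eq0. Qed.

(** The value at 0 of the prime product is the indicator of [k = 1], and its
    derivative is nonzero only for a prime power [k]. By the product rule the
    first of these selects the logarithmic derivative of [zeta], the second the
    von Mangoldt term. *)
Lemma is_Cderive_Zterm_first (a D : C) (h k : nat) : (0 < k)%nat ->
  0 < Re (1 + a) -> a <> 0 -> zeta (1 + a) <> 0 -> is_Cderive zeta (1 + a)%C D ->
  is_Cderive (fun g => Zterm a g h k) (RtoC 0)
    (RtoC (if k == 1%nat then 1 else 0) / cpow (INR h) a * (D / zeta (1 + a))
     - RtoC (vonMangoldt k) / (cpow (INR h) a * Phi (1 + a) k))%C.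
Proof.
move=> hk hre ha hz hD; rewrite /Zterm inv_zeta_neq1; last exact: Cplus1_neq1.
set H := cpow (INR h) a; have hH : H <> 0 by exact: cpow_neq0.
pose f (p : nat) g := ((1 - cpow (INR p) g) / (1 - cpow (INR p) (- (1) - a)))%C.
have dk := is_Cderive_mult (is_Cderive_const H 0) (is_Cderive_cpow (INR k) (is_Cderive_id 0)).
have dz := @is_Cderive_comp zeta (fun g => 1 + a + g)%C 0 D _.
have dz' : is_Cderive (fun g => zeta (1 + a + g)) (RtoC 0) D.
  apply: is_Cderive_eq (dz (0 + 1)%C _ _) _; last by ring.
    by rewrite Cplus_0_r.
  exact: is_Cderive_plus (is_Cderive_const _ _) (is_Cderive_id _).
have nk : (H * cpow (INR k) 0)%C <> 0 by rewrite cpow_0 Cmult_1_r.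
have dU := is_Cderive_mult (is_Cderive_div (is_Cderive_const 1 0) dk nk)
   (is_Cderive_mult dz' (is_Cderive_const (/ zeta (1 + a))%C 0)).
have dP := @is_Cderive_Cprod_zeros (primes k) f
  (fun p => - (RtoC (ln (INR p)) / (1 - cpow (INR p) (- (1) - a))))%C 0.
have {}dP := is_Cderive_mult dU (dP _ _).
apply: is_Cderive_eq (dP _ _) _.
- by move=> p; rewrite /f cpow_0 /Cdiv; ring.
- move=> p; apply: is_Cderive_eq (is_Cderive_mult (is_Cderive_minus (is_Cderive_const 1 0)
    (is_Cderive_cpow (INR p) (is_Cderive_id 0))) (is_Cderive_const _ 0)) _.
  by rewrite cpow_0 /Cdiv; ring.
rewrite -(primes_nil hk) vonMangoldt_primes /Phi Cplus_0_r !cpow_0.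
case E : (primes k) => [|p [|q ps]].
- have -> : k = 1%nat by apply/eqP; rewrite -(primes_nil hk) E.
  rewrite !big_nil eqxx [INR 1]/= ln_1. by field.
- rewrite !big_cons !big_nil /f cpow_0.
  have -> : (- (1) - a = - (1 + a))%C by ring.
  have hp : (1 < p)%nat.
    by have := mem_head p [::]; rewrite -E mem_primes => /andP [/prime_gt1].
  have hc := cpow_prime_neq1 hp hre.
  set c := (1 - _)%C in hc *.
  have -> : ([:: p] == [::]) = false by [].
  by field; do !split => //.
- have -> : ([:: p, q & ps] == [::]) = false by [].
  by rewrite !big_cons /f cpow_0 /Cdiv; ring.
Qed.

(** The factor [inv_zeta (1 - g)] has a simple zero at [g = 0] with derivative
    -1, so the derivative of the whole term is minus the value of the other
    factors. *)
Lemma is_Cderive_Zterm_second (a : C) (h k : nat) : (0 < k)%nat ->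
  Re a < 1 -> a <> 0 ->
  is_Cderive (fun g => Zterm (- g) (- a) h k) (RtoC 0)
    (- (RtoC (INR k / INR (totient k)) * Phi a k * zeta (1 - a) * cpow (INR k) a))%C.
Proof.
move=> hk hre ha; rewrite /Zterm totient_ratio // /Phi.
have hs : (1 - a)%C <> 1.
  apply: Cplus1_neq1 => h0; apply: ha.
  have -> : a = (- - a)%C by ring.
  by rewrite h0; ring.
have hs0 : 0 < Re (1 - a) by rewrite /Re /=; move: hre; rewrite /Re; lra.
have [D hD] := ex_Cderive_zeta hs hs0.
have dN : is_Cderive (fun g => - g)%C (RtoC 0) (- (1))%C.
  exact: (is_derive_opp (V := C_NormedModule) _ _ _ (is_Cderive_id 0)).
have N0 : (- 0)%C = 0 by ring.
have dzeta : is_Cderive (fun g => zeta (1 + - g + - a)) (RtoC 0) (D * - (1))%C.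
  apply: (@is_Cderive_comp zeta (fun g => 1 + - g + - a)%C).
    by have -> : (1 + - 0 + - a = 1 - a)%C by ring.
  apply: is_Cderive_eq (is_Cderive_plus (is_Cderive_plus (is_Cderive_const 1 0) dN)
    (is_Cderive_const _ 0)) _; ring.
have dinv : is_Cderive (fun g => inv_zeta (1 + - g)) (RtoC 0) (- (1))%C.
  apply: is_Cderive_eq (@is_Cderive_comp inv_zeta (fun g => 1 + - g)%C 0 1 (0 + - (1))%C _ _) _.
  - by rewrite N0 Cplus_0_r; exact: is_Cderive_inv_zeta.
  - exact: is_Cderive_plus (is_Cderive_const 1 0) dN.
  by ring.
pose f (p : nat) g := ((1 - cpow (INR p) (- a)) / (1 - cpow (INR p) (- (1) - - g)))%C.
have [Q hQ] : exists Q, is_Cderive (fun g => \Cprod_(p <- primes k) f p g) (RtoC 0) Q.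
  apply: ex_Cderive_Cprod => p; rewrite mem_primes => /andP [/prime_gt1 hp _].
  eexists; apply: is_Cderive_div (is_Cderive_const _ _) _ _.
    apply: is_Cderive_minus (is_Cderive_const 1 0) (is_Cderive_cpow _ _).
    exact: is_Cderive_minus (is_Cderive_const _ 0) dN.
  have -> : (- (1) - - 0 = - (1))%C by ring.
  by apply: cpow_prime_neq1 => //; rewrite /Re /=; lra.
have dk := is_Cderive_mult (is_Cderive_cpow (INR h) dN) (is_Cderive_const (cpow (INR k) (- a)) 0).
have nk : (cpow (INR h) (- 0) * cpow (INR k) (- a))%C <> 0.
  by apply: Cmult_neq_0; exact: cpow_neq0.
have := is_Cderive_mult (is_Cderive_mult (is_Cderive_div (is_Cderive_const 1 0) dk nk)
  (is_Cderive_mult dzeta dinv)) hQ.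
move=> H; apply: is_Cderive_eq H _.
rewrite N0 Cplus_0_r inv_zeta_1 cpow_0 (cpow_opp (INR k)).
have -> : \Cprod_(p <- primes k) f p 0
    = (\Cprod_(p <- primes k) (/ (1 - cpow (INR p) (- (1))))
       * \Cprod_(p <- primes k) (1 - cpow (INR p) (- a)))%C.
  rewrite -Cprod_mult; apply: eq_bigr => p _; rewrite /f.
  have -> : (- (1) - - 0 = - (1))%C by ring.
  by rewrite /Cdiv; ring.
have hka := @cpow_neq0 (INR k) a.
change (1 + - a)%C with (1 - a)%C; by field.
Qed.

(** * The derivative of the mean *)

(** The value of [mean_integral (Cconj a) h k T] near [g = 0]. *)
Definition mean_closed_form (a : C) (h k : nat) (T : R) (g : C) : C :=
  (RtoC (/ (2 * PI)) * (Zterm a g h k * RtoC T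
     + cpow (/ (2 * PI)) (- a - g) * Zterm (- g) (- a) h k / (- a - g + 1)
       * cpow T (- a - g + 1)))%C.

(** Because of this zero, the derivative of the powers of [T] and [2 pi] that
    multiply the second term does not contribute at [g = 0]. *)
Lemma Zterm_second_0 (a : C) (h k : nat) : Zterm (- 0) (- a) h k = 0.
Proof.
rewrite /Zterm; have -> : (1 + - 0)%C = 1 by ring.
by rewrite inv_zeta_1; ring.
Qed.

Lemma is_Cderive_mean_closed_form (a : C) (h k : nat) (T : R) :
  (0 < k)%nat -> 0 < T -> a <> 0 -> Cmod a <= / 7 ->
  is_Cderive (mean_closed_form a h k T) (RtoC 0)
   (RtoC (T / (2 * PI))
   * (RtoC (if k == 1%nat then 1 else 0) / cpow (INR h) a
        * (C_derive zeta (1 + a) / zeta (1 + a))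
      - RtoC (vonMangoldt k) / (cpow (INR h) a * Phi (1 + a) k)
      - RtoC (INR k / INR (totient k)) * Phi a k * zeta (1 - a)
        * (cpow (T / (2 * PI * INR k)) (- a) / (1 - a))))%C.
Proof.
move=> hk hT ha0 ha.
have hRe : - / 7 <= Re a <= / 7.
  have := re_le_Cmod a; have := Rle_abs (Re a).
  by have := Rle_abs (- Re a); rewrite Rabs_Ropp; lra.
have hre1 : 0 < Re (1 + a) by rewrite /Re /=; move: hRe; rewrite /Re; lra.
have hre2 : Re a < 1 by lra.
have hz := zeta_neq0_near_pole ha0 ha.
have [D hD] := ex_Cderive_zeta (Cplus1_neq1 ha0) hre1.
rewrite (is_C_derive_unique _ _ _ hD).
have dA := is_Cderive_Zterm_first h hk hre1 ha0 hz hD.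
have dB := is_Cderive_Zterm_second h hk hre2 ha0.
have h1a : (1 - a)%C <> 0.
  by move=> /(f_equal Re); rewrite /Re /=; move: hre2; rewrite /Re; lra.
have dlin : is_Cderive (fun g => - a - g)%C (RtoC 0) (0 - 1)%C.
  exact: is_Cderive_minus (is_Cderive_const (- a)%C 0) (is_Cderive_id 0).
have dlin1 := is_Cderive_plus dlin (is_Cderive_const 1 0).
have n1 : (- a - 0 + 1)%C <> 0 by have -> : (- a - 0 + 1 = 1 - a)%C by ring.
have dM := is_Cderive_mult (is_Cderive_const (RtoC (/ (2 * PI))) 0)
  (is_Cderive_plus (is_Cderive_mult dA (is_Cderive_const T 0))
    (is_Cderive_mult (is_Cderive_div (is_Cderive_mult (is_Cderive_cpow (/ (2 * PI)) dlin) dB) dlin1 n1)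
      (is_Cderive_cpow T dlin1))).
apply: is_Cderive_eq dM _; rewrite Zterm_second_0.
have e0 : (- a - 0 = - a)%C by ring.
have e1 : (- a + 1 = 1 - a)%C by ring.
rewrite !e0 !e1 cpow_1_minus //.
have hpi := PI_RGT_0.
have hk0 : 0 < INR k by apply: (lt_INR 0); apply/ltP.
have -> : cpow (T / (2 * PI * INR k)) (- a)
  = (cpow T (- a) * cpow (/ (2 * PI)) (- a) * cpow (INR k) a)%C.
  have -> : T / (2 * PI * INR k) = T * / (2 * PI) * / INR k.
    by field; lra.
  have ipi : 0 < / (2 * PI) by apply: Rinv_0_lt_compat; lra.
  have ik : 0 < / INR k by exact: Rinv_0_lt_compat.
  rewrite !cpow_mult //; last exact: Rmult_lt_0_compat.
  congr Cmult; rewrite /cpow ln_Rinv // RtoC_opp; congr Cexp; ring.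
(* keeps these denominators away from [field], which would ask for the
   non-vanishing of [Phi] *)
set X := (_ / (_ * Phi _ _))%C; set Y := (_ / _ * (_ / zeta _))%C.
by rewrite /Rdiv (RtoC_mult T); field.
Qed.

Lemma Phi_conj (s : C) (k : nat) : Cconj (Phi s k) = Phi (Cconj s) k.
Proof.
rewrite /Phi Cprod_conj; apply: eq_bigr => p _.
by rewrite Cminus_conj cpow_conj Copp_conj Cconj_RtoC.
Qed.

(* Besides the formula, the conclusion records that its left-hand side is
   meaningful: the integrals converge for gamma near 0, and their mean is
   complex differentiable at 0. *)
Theorem lemma3p7 (T : R) (h k : nat) (alpha : C)
  (hT : 2 <= T) (hh : (0 < h)%nat) (hk : (0 < k)%nat)
  (alpha_neq0 : alpha <> (RtoC 0)) (alpha_le : Cmod alpha <= 1 / (15 * ln T)) :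
  locally (T := C_UniformSpace) (RtoC 0) (fun gamma : C =>
    ex_RInt_gen (V := C_R_NormedModule)
      (integrand alpha h k gamma) (at_right 0) (at_point T))
  /\ ex_derive (K := C_AbsRing) (V := C_NormedModule)
       (mean_integral alpha h k T) (RtoC 0)
  /\ Cconj (C_derive (mean_integral alpha h k T) (RtoC 0)) = Fmain alpha h k T.
Proof.
have hT0 : 0 < T by lra.
have ha7 : Cmod alpha <= / 7.
  have h2 := ln_lt_2.
  have h3 : ln 2 <= ln T by apply: ln_le; lra.
  apply: Rle_trans alpha_le _; rewrite /Rdiv Rmult_1_l.
  by apply: Rinv_le_contravar; lra.
pose a := Cconj alpha.
have ha : Cmod a <= / 7 by rewrite /a Cmod_conj.
have ha0 : a <> 0 by move=> e; apply: alpha_neq0; rewrite -(Cconj_conj alpha) -/a e Cconj_RtoC.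
have hnear : locally (T := C_UniformSpace) (RtoC 0) (fun g : C => Re (a + g) < 1).
  have hlt : 0 < / 2 by lra.
  exists (mkposreal _ hlt) => g [hg _].
  have {}hg : Rabs (g.1 + - 0) < / 2 by exact: hg.
  have -> : Re (a + g) = Re a + g.1 by [].
  have := re_le_Cmod a; have := Rle_abs (Re a); have := Rle_abs (g.1 + - 0); lra.
split.
  apply: filter_imp hnear => g hg; eexists; exact: is_RInt_gen_integrand hT0 hg.
have heq : locally (T := AbsRing_UniformSpace C_AbsRing) (RtoC 0)
    (fun g => mean_closed_form a h k T g = mean_integral alpha h k T g).
  apply/locally_C; apply: filter_imp hnear => g hg.
  rewrite /mean_integral /mean_closed_form; congr Cmult; symmetry.
  exact: (is_RInt_gen_unique (V := C_R_CompleteNormedModule) _ _ (is_RInt_gen_integrand hT0 hg)).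
have dM := is_derive_ext_loc (V := C_NormedModule) _ _ _ _ heq
  (is_Cderive_mean_closed_form h hk hT0 ha0 ha).
split; first by eexists; exact: dM.
rewrite (is_C_derive_unique _ _ _ dM) /Fmain.
have hre : 0 < Re (1 + a).
  have -> : Re (1 + a) = 1 + Re a by [].
  by have := re_le_Cmod a; have := Rle_abs (- Re a); rewrite Rabs_Ropp; lra.
have c1 : Cconj (1 + a) = (1 + alpha)%C by rewrite Cplus_conj Cconj_RtoC Cconj_conj.
have c2 : Cconj (1 - a) = (1 - alpha)%C by rewrite Cminus_conj Cconj_RtoC Cconj_conj.
rewrite !(Cminus_conj, Cmult_conj, Cconj_div, Cconj_RtoC, Phi_conj, cpow_conj).
rewrite -(C_derive_zeta_conj (Cplus1_neq1 ha0) hre) -!zeta_conj !c1 c2.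
by rewrite Copp_conj Cconj_conj.
Qed.
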